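(* Let $h_w(x)=\langle w,x\rangle$ with $w\in\mathbb R^d$, assume that $\|x\|\le M$ for all $x\in X\subset\mathbb R^d$, and fix $\rho>0$. Define the Huber loss by $$L_\rho(z,y):=\begin{cases}\dfrac{(z-y)^2}{2\rho},&\text{if }|z-y|\le\rho,\\[1.2ex]|z-y|-\dfrac\rho2,&\text{if }|z-y|>\rho.\end{cases}$$ Let $D$ be a distribution on $X\times\mathbb R$ such that $|y|\le Y_{\max}$ almost surely, and define $Y_{\rho,\max}:=\sup_{|y|\le Y_{\max}}L_\rho(0,y)$. Let $\Theta:=\{w\in\mathbb R^d:\|w\|\le R\}$, let $P=\mathcal N(0,\sigma^2I_d)$ with $\sigma>0$, and let $\delta\in(0,1]$. Then, with probability at least $1-\delta$ over $S\sim D^n$, we have uniformly for all $w\in\Theta$, $$\begin{aligned}L_{\rho,D}(h_w)\le{}&L_{\rho,S}(h_w)+\frac{2R\sigma M^2}{\rho\sqrt n}+\frac{4M^2\sigma^2}{\rho}\sqrt{\frac{2\ln(16/\delta)}{n}}+Y_{\rho,\max}\sqrt{\frac{\ln(2/\delta)}{2n}}\\&+\frac{M\sqrt{d+1}}{2\sigma\sqrt n}\|w\|^2+\frac{M\sigma\sqrt{d+1}}{\sqrt n}\left(\ln\frac4\delta+\frac12\right).\end{aligned}$$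
   Context: $L_{\rho,D}(h):=\mathbb E_{(x,y)\sim D}[L_\rho(h(x),y)]$ and, for $S=\{(x_i,y_i)\}_{i=1}^n$, $L_{\rho,S}(h):=\frac1n\sum_{i=1}^nL_\rho(h(x_i),y_i)$. *)

(* Defs.v *)
From HB Require Import structures.
From mathcomp Require Import all_boot all_order all_algebra.
From mathcomp Require Import all_classical all_reals all_analysis.

Set Implicit Arguments.
Unset Strict Implicit.
Unset Printing Implicit Defensive.

Import Order.TTheory GRing.Theory Num.Theory.
Import numFieldNormedType.Exports.

Local Open Scope classical_set_scope.
Local Open Scope ring_scope.

Notation borel_rV R d := (g_sigma_algebraType (@open 'rV[R]_d)).

(* The norm `|x| of 'rV[R]_d is the sup norm, hence a separate Euclidean norm. *)
Definition dotp (R : realType) (d : nat) (u v : 'rV[R]_d) : R :=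
  \sum_(i < d) u ord0 i * v ord0 i.

Definition enorm (R : realType) (d : nat) (u : 'rV[R]_d) : R :=
  Num.sqrt (dotp u u).

Section product_power.
Context {disp : measure_display} {T : measurableType disp} {R : realType}.

Definition cons_tuple n (p : T * n.-tuple T) : n.+1.-tuple T :=
  [tuple of p.1 :: p.2].

Lemma measurable_cons_tuple n : measurable_fun setT (@cons_tuple n).
Proof. exact: measurable_cons. Qed.

HB.instance Definition _ n := isMeasurableFun.Build _ _ _ _
  (@cons_tuple n) (@measurable_cons_tuple n).

(* The product measure D^n; power_probE is its characterization on
   rectangles. *)
Fixpoint power_prob (D : probability T R) (n : nat) :
    probability (n.-tuple T) R :=
  match n with
  | 0 => \d_[tuple]
  | m.+1 => distribution (D \x power_prob D m)%E (@cons_tuple m)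
  end.

Lemma power_probE (D : probability T R) n (A : 'I_n -> set T) :
  (forall i, measurable (A i)) ->
  power_prob D n [set S | forall i, A i (tnth S i)] = (\prod_(i < n) D (A i))%E.
Proof.
elim: n A => [|n IHn] A mA.
  by rewrite big_ord0 /= diracE mem_set// => -[].
rewrite big_ord_recl -IHn => [|i]; last exact: mA.
rewrite -product_measure1E//; last first.
  rewrite [X in measurable X](_ : _ =
      \bigcap_(i in [set: 'I_n]) (fun S => tnth S i) @^-1` A (lift ord0 i)).
    apply: fin_bigcap_measurable => // i _; rewrite -[X in measurable X]setTI.
    exact: measurable_tnth.
  by apply/seteqP; split => S /= h i; [move=> _|]; exact: h.
rewrite /= /distribution /pushforward; congr (_ _).
apply/seteqP; split => [[x S]/= h|[x S] /= [Ax h] i].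
  split; first exact: h ord0.
  by move=> i; have := h (lift ord0 i); rewrite tnthS.
have [j ->|->] := unliftP ord0 i; first by rewrite tnthS; exact: h.
by rewrite tnth0.
Qed.

End product_power.

Section gaussian.
Context {R : realType}.

Definition row_of_tuple d (t : d.-tuple (measurableTypeR R)) : borel_rV R d :=
  \row_(i < d) tnth t i.

Lemma measurable_row_of_tuple d : measurable_fun setT (@row_of_tuple d).
Proof.
pose B (p : 'rV[rat]_d * nat) : set 'rV[R]_d :=
  [set v | forall i, `|ratr (p.1 ord0 i) - v ord0 i| < p.2.+1%:R^-1].
have mB p : measurable (@row_of_tuple d @^-1` B p).
  rewrite (_ : _ @^-1` _ = \bigcap_(i in [set: 'I_d])
      (fun t => tnth t i) @^-1` ball (ratr (p.1 ord0 i) : R) p.2.+1%:R^-1).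
    apply: fin_bigcap_measurable => // i _; rewrite -[X in measurable X]setTI.
    by apply: measurable_tnth => //; rewrite ball_itv; exact: (@measurable_itv R).
  by apply/seteqP; split => t /= h i; [move=> _|]; have := h i;
    rewrite /ball /= mxE//; exact.
have h := @measurability _ _ (d.-tuple (measurableTypeR R)) (borel_rV R d) setT
  (@row_of_tuple d) (@open 'rV[R]_d).
apply: h => // _ [U oU <-].
rewrite setTI.
rewrite (_ : _ @^-1` U =
    \bigcup_(p in [set p | B p `<=` U]) (@row_of_tuple d @^-1` B p)).
  rewrite bigcup_mkcond; apply: countable_bigcupT_measurable => // p.
  by case: ifP => _; [exact: mB|exact: measurable0].
apply/seteqP; split => [t Ut|t [p /= BU Bt]]; last exact: BU.
have /nbhs_ballP[e /= e0 eU] : nbhs (row_of_tuple t : 'rV[R]_d) U.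
  exact: open_nbhs_nbhs.
have [k ke] : exists k : nat, k.+1%:R^-1 < e / 2.
  have [k _ kP] := near_infty_natSinv_lt (PosNum (divr_gt0 e0 (ltr0Sn R 1))).
  by exists k; exact: (kP k (leqnn k)).
have /choice[q qP] : forall i : 'I_d, exists q : rat,
    `|ratr q - tnth t i| < k.+1%:R^-1.
  move=> i; have /rat_in_itvoo[q p] : tnth t i - k.+1%:R^-1 < tnth t i + k.+1%:R^-1.
    by rewrite ltrBlDr -addrA ltrDl addr_gt0 ?invr_gt0.
  by exists q; move: p; rewrite in_itv /= ltr_distl.
exists (\row_i q i, k) => [v /= Bv|i /=]; last by rewrite !mxE.
apply: eU; split => // a b; rewrite ord1 /ball /= mxE.
have := Bv b; rewrite /= mxE => Bvb; have := ltrD (qP b) Bvb.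
rewrite -mulr2n -(mulr_natr _ 2) => h; apply: le_lt_trans (lt_trans h _).
  rewrite (distrC (ratr _)) -[X in `|X|](subrKA (ratr (q b))).
  exact: ler_normD.
by rewrite -ltr_pdivlMr.
Qed.

HB.instance Definition _ d := isMeasurableFun.Build _ _ _ _
  (@row_of_tuple d) (@measurable_row_of_tuple d).

(* N(0, sigma^2 I_d), as the law of d independent N(0, sigma^2) coordinates; the second
   argument of normal_prob is the standard deviation. *)
Definition gaussian_prob (d : nat) (sigma : R) : probability (borel_rV R d) R :=
  distribution (power_prob (normal_prob 0 sigma) d) (@row_of_tuple d).

End gaussian.

Section huber.
Context {R : realType}.

Definition huber (rho z y : R) : R :=
  if `|z - y| <= rho then (z - y) ^+ 2 / (2 * rho) else `|z - y| - rho / 2.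

Definition huber_max (rho Ymax : R) : R :=
  sup [set huber rho 0 y | y in [set y | `|y| <= Ymax]].

Definition true_risk d (rho : R) (D : probability (borel_rV R d * R)%type R)
    (h : 'rV[R]_d -> R) : \bar R :=
  'E_D[fun p => huber rho (h p.1) p.2].

Definition emp_risk d n (rho : R) (S : n.-tuple (borel_rV R d * R))
    (h : 'rV[R]_d -> R) : R :=
  n%:R^-1 * \sum_(i < n) huber rho (h (tnth S i).1) (tnth S i).2.

End huber.

(* A need not be known to be measurable: the bound is on its inner measure. *)
Definition holds_with_prob_ge disp (T : measurableType disp) (R : realType)
    (P : probability T R) (p : R) (A : set T) : Prop :=
  exists B : set T, [/\ measurable B, B `<=` A & (p%:E <= P B)%E].

(* Main.v *)
Require Import Defs.
From HB Require Import structures.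
From mathcomp Require Import all_boot all_order all_algebra.
From mathcomp Require Import all_classical all_reals all_analysis.
From mathcomp Require Import measurable_realfun.
From mathcomp Require Import ring lra.

Import Order.TTheory GRing.Theory Num.Theory.
Import numFieldNormedType.Exports.

Local Open Scope classical_set_scope.
Local Open Scope ring_scope.

(** Write [L_D(w) - L_S(w)] as the sum of three deviations: that of the loss averaged over the
Gaussian posterior N(w, s^2 I), relative to the loss at [0]; that of the loss at [0]; and that
of the smoothing error [E L(w + g) - L(w)], with the opposite sign.  The first is controlled by
PAC-Bayes with the Gaussian prior, whose relative entropy to the posterior is
[|w|^2 / (2 s^2)], the second by Hoeffding's inequality.  Since the Huber loss is
[1 / rho]-smooth, the smoothing error lies in [0, s^2 M^2 / (2 rho)] and is
[s M / rho]-Lipschitz in the prediction, so symmetrization, contraction and McDiarmid's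
inequality bound the third uniformly over the ball. *)

Set Implicit Arguments.
Unset Strict Implicit.

(** * Bounded measurable functions and powers of a probability *)

(** The linear class has no loss bound uniform in [w] over the Gaussian's support. Subtracting the
    loss at [0] leaves a difference bounded by [M * enorm v], so Hoeffding's exponent is quadratic
    in [v] and can be integrated against the prior when [l] is not too large. With
    [l = sqrt n / (M s sqrt (d + 1))] that integral is at most [expR (1 / 2)], and dividing
    [|w|^2 / (2 s^2) + ln (4 / delta) + 1 / 2] by [l] gives the last two terms of the bound. The
    smoothing error does not vanish as [n] grows, but it enters the true and the empirical risk
    alike, so only the difference of its two means has to be paid for. The failure probability is
    split as [delta / 2] for the loss at [0] and [delta / 4] for each of the other two deviations. A
    supremum over the ball raises measurability questions; the expectations are therefore taken of
    maxima over finite sets, followed by a countable dense set and continuity in [w]. *)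

Definition bounded_mfun disp (T : measurableType disp) (R : realType)
    (f : T -> R) : Prop :=
  measurable_fun setT f /\ exists K, forall x, `|f x| <= K.

Section bounded_measurable.
Context {disp : measure_display} {T : measurableType disp} {R : realType}.
Implicit Types f g : T -> R.

Lemma bounded_mfun_cst (c : R) : bounded_mfun (fun _ : T => c).
Proof. by split => //; exists `|c|. Qed.

Lemma bounded_mfunD f g :
  bounded_mfun f -> bounded_mfun g -> bounded_mfun (fun x => f x + g x).
Proof.
move=> [mf [K fK]] [mg [L gL]]; split; first exact: measurable_funD.
by exists (K + L) => x; apply: le_trans (ler_normD _ _) _; exact: lerD.
Qed.

Lemma bounded_mfunM f g :
  bounded_mfun f -> bounded_mfun g -> bounded_mfun (fun x => f x * g x).
Proof.
move=> [mf [K fK]] [mg [L gL]]; split; first exact: measurable_funM.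
by exists (K * L) => x; rewrite normrM ler_pM.
Qed.

Lemma bounded_mfunN f : bounded_mfun f -> bounded_mfun (fun x => - f x).
Proof.
move=> [mf [K fK]]; split; first exact: measurable_funN.
by exists K => x; rewrite normrN.
Qed.

Lemma bounded_mfunB f g :
  bounded_mfun f -> bounded_mfun g -> bounded_mfun (fun x => f x - g x).
Proof. by move=> bf bg; apply: bounded_mfunD => //; exact: bounded_mfunN. Qed.

Lemma bounded_mfun_max f g :
  bounded_mfun f -> bounded_mfun g -> bounded_mfun (fun x => Num.max (f x) (g x)).
Proof.
move=> [mf [K fK]] [mg [L gL]]; split; first exact: measurable_maxr.
exists (Num.max K L) => x; rewrite {1}/Order.max.
by case: ifP => _; rewrite le_max ?fK ?gL ?orbT.
Qed.

Lemma bounded_mfun_sum (I : Type) (s : seq I) (F : I -> T -> R) :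
  (forall i, bounded_mfun (F i)) -> bounded_mfun (fun x => \sum_(i <- s) F i x).
Proof.
move=> bF; elim: s => [|i s IH].
  by under eq_fun do rewrite big_nil; exact: bounded_mfun_cst.
by under eq_fun do rewrite big_cons; exact: bounded_mfunD.
Qed.

Lemma bounded_mfun_bigmax (I : Type) (s : seq I) (F : I -> T -> R) (i0 : I) :
  (forall i, bounded_mfun (F i)) ->
  bounded_mfun (fun x => \big[Num.max/F i0 x]_(i <- s) F i x).
Proof.
move=> bF; elim: s => [|i s IH].
  by under eq_fun do rewrite big_nil; exact: bF.
by under eq_fun do rewrite big_cons; exact: bounded_mfun_max.
Qed.

Lemma bounded_mfun_expR f : bounded_mfun f -> bounded_mfun (fun x => expR (f x)).
Proof.
move=> [mf [K fK]]; split; first exact: measurableT_comp.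
exists (expR K) => x; rewrite ger0_norm ?expR_ge0// ler_expR.
exact: le_trans (ler_norm _) (fK x).
Qed.

Lemma bounded_mfun_comp disp' (U : measurableType disp') (h : U -> T) f :
  measurable_fun setT h -> bounded_mfun f -> bounded_mfun (f \o h).
Proof.
move=> mh [mf [K fK]]; split; first exact: measurableT_comp.
by exists K => x /=.
Qed.

Lemma bounded_mfun_integrable (P : probability T R) f :
  bounded_mfun f -> P.-integrable setT (EFin \o f).
Proof.
move=> [mf [K fK]]; apply: measurable_bounded_integrable => //.
  by rewrite /= probability_setT ltry.
exists K; split; first exact: num_real.
by move=> x Kx y _; apply: le_trans (fK y) (ltW Kx).
Qed.

Lemma EFin_Rintegral (P : probability T R) f :
  P.-integrable setT (EFin \o f) ->
  (\int[P]_x f x)%:E = (\int[P]_x (f x)%:E)%E.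
Proof. by move=> intf; rewrite fineK//; exact: integrable_fin_num. Qed.

Lemma Rintegral_prob_cst (P : probability T R) (c : R) : \int[P]_x c = c.
Proof. by rewrite Rintegral_cst//= probability_setT mulr1. Qed.

Lemma Rintegral_le_cst (P : probability T R) f (c : R) :
  bounded_mfun f -> (forall x, f x <= c) -> \int[P]_x f x <= c.
Proof.
move=> bf fc; rewrite -[leRHS](Rintegral_prob_cst P); apply: le_Rintegral => //.
- exact: bounded_mfun_integrable.
- exact: bounded_mfun_integrable (bounded_mfun_cst c).
Qed.

Lemma Rintegral_ge_cst (P : probability T R) f (c : R) :
  bounded_mfun f -> (forall x, c <= f x) -> c <= \int[P]_x f x.
Proof.
move=> bf fc; rewrite -[leLHS](Rintegral_prob_cst P); apply: le_Rintegral => //.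
- exact: bounded_mfun_integrable (bounded_mfun_cst c).
- exact: bounded_mfun_integrable.
Qed.

Lemma le_Rintegral_bounded (P : probability T R) f g :
  bounded_mfun f -> bounded_mfun g -> (forall x, f x <= g x) ->
  \int[P]_x f x <= \int[P]_x g x.
Proof.
by move=> bf bg fg; apply: le_Rintegral => //; exact: bounded_mfun_integrable.
Qed.

Lemma RintegralD_bounded (P : probability T R) f g :
  bounded_mfun f -> bounded_mfun g ->
  \int[P]_x (f x + g x) = \int[P]_x f x + \int[P]_x g x.
Proof. by move=> bf bg; rewrite RintegralD//; exact: bounded_mfun_integrable. Qed.

Lemma RintegralB_bounded (P : probability T R) f g :
  bounded_mfun f -> bounded_mfun g ->
  \int[P]_x (f x - g x) = \int[P]_x f x - \int[P]_x g x.
Proof. by move=> bf bg; rewrite RintegralB//; exact: bounded_mfun_integrable. Qed.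

Lemma RintegralZl_bounded (P : probability T R) f (c : R) :
  bounded_mfun f -> \int[P]_x (c * f x) = c * \int[P]_x f x.
Proof. by move=> bf; rewrite RintegralZl//; exact: bounded_mfun_integrable. Qed.

End bounded_measurable.

Section bounded_fubini.
Context {d1 d2 : measure_display} {T1 : measurableType d1}
  {T2 : measurableType d2} {R : realType}.
Context (P : probability T1 R) (Q : probability T2 R) (f : T1 * T2 -> R).
Hypothesis bf : bounded_mfun f.

Lemma bounded_mfun_section1 y : bounded_mfun (fun x => f (x, y)).
Proof. exact: (bounded_mfun_comp (pair2_measurable y) bf). Qed.

Lemma bounded_mfun_section2 x : bounded_mfun (fun y => f (x, y)).
Proof. exact: (bounded_mfun_comp (pair1_measurable x) bf). Qed.

Let intf : (P \x Q)%E.-integrable setT (EFin \o f).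
Proof. exact: (@bounded_mfun_integrable _ _ _ (P \x Q)%E). Qed.

Lemma bounded_mfun_Rintegral2 : bounded_mfun (fun x => \int[Q]_y f (x, y)).
Proof.
split.
  have := measurable_fubini_F intf.
  by move=> /(measurableT_comp (fine_measurable measurableT)).
have [_ [K fK]] := bf; exists K => x; rewrite ler_norml; apply/andP; split.
  apply: Rintegral_ge_cst; first exact: bounded_mfun_section2.
  by move=> y; have := fK (x, y); rewrite ler_norml => /andP[].
apply: Rintegral_le_cst; first exact: bounded_mfun_section2.
by move=> y; have := fK (x, y); rewrite ler_norml => /andP[].
Qed.

Lemma bounded_mfun_Rintegral1 : bounded_mfun (fun y => \int[P]_x f (x, y)).
Proof.
split.
  have := measurable_fubini_G intf.
  by move=> /(measurableT_comp (fine_measurable measurableT)).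
have [_ [K fK]] := bf; exists K => y; rewrite ler_norml; apply/andP; split.
  apply: Rintegral_ge_cst; first exact: bounded_mfun_section1.
  by move=> x; have := fK (x, y); rewrite ler_norml => /andP[].
apply: Rintegral_le_cst; first exact: bounded_mfun_section1.
by move=> x; have := fK (x, y); rewrite ler_norml => /andP[].
Qed.

Lemma bounded_Rfubini12 :
  \int[(P \x Q)%E]_z f z = \int[P]_x \int[Q]_y f (x, y).
Proof.
rewrite [LHS]/Rintegral -(integral12_prod_meas1 intf); congr fine.
apply: eq_integral => x _; rewrite /fubini_F EFin_Rintegral//.
exact/bounded_mfun_integrable/bounded_mfun_section2.
Qed.

Lemma bounded_Rfubini21 :
  \int[(P \x Q)%E]_z f z = \int[Q]_y \int[P]_x f (x, y).
Proof.
rewrite [LHS]/Rintegral -(integral21_prod_meas1 intf); congr fine.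
apply: eq_integral => y _; rewrite /fubini_G EFin_Rintegral//.
exact/bounded_mfun_integrable/bounded_mfun_section1.
Qed.

Lemma bounded_Rfubini :
  \int[P]_x \int[Q]_y f (x, y) = \int[Q]_y \int[P]_x f (x, y).
Proof. by rewrite -bounded_Rfubini12 bounded_Rfubini21. Qed.

End bounded_fubini.

Section power_prob_integral.
Context {disp : measure_display} {T : measurableType disp} {R : realType}.
Context (D : probability T R).

Lemma ge0_integral_power_probS n (f : n.+1.-tuple T -> \bar R) :
  measurable_fun setT f -> (forall S, 0 <= f S)%E ->
  (\int[power_prob D n.+1]_S f S =
   \int[D]_x \int[power_prob D n]_S f (Defs.cons_tuple (x, S)))%E.
Proof.
move=> mf f0; rewrite /= ge0_integral_distribution//.
rewrite fubini_tonelli1//.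
- exact: measurableT_comp.
- by move=> x; exact: f0.
Qed.

Lemma bounded_mfun_cons n (f : n.+1.-tuple T -> R) :
  bounded_mfun f -> bounded_mfun (f \o @Defs.cons_tuple _ T n).
Proof. exact: bounded_mfun_comp. Qed.

Lemma Rintegral_power_probS n (f : n.+1.-tuple T -> R) : bounded_mfun f ->
  \int[power_prob D n.+1]_S f S =
  \int[D]_x \int[power_prob D n]_S f (Defs.cons_tuple (x, S)).
Proof.
move=> bf; rewrite -(bounded_Rfubini12 _ _ (bounded_mfun_cons bf)).
have bfc := bounded_mfun_integrable (D \x power_prob D n)%E (bounded_mfun_cons bf).
congr fine; apply: (integral_distribution _ bfc).
by apply/measurable_EFinP; case: bf.
Qed.

Lemma Rintegral_power_prob0 (f : 0.-tuple T -> R) :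
  \int[power_prob D 0]_S f S = f [tuple].
Proof.
rewrite (@eq_Rintegral _ _ _ _ _ (fun=> f [tuple])).
  by rewrite Rintegral_prob_cst.
by move=> S _; rewrite tuple0.
Qed.

End power_prob_integral.

(** * Hoeffding's lemma and McDiarmid's inequality *)

Lemma mean_value (R : realType) (f df : R -> R) (a b : R) : a <= b ->
  (forall x : R, is_derive x (1 : R) f (df x)) ->
  exists2 c, a <= c <= b & f b - f a = df c * (b - a).
Proof.
move=> ab dfx; have [|c] := @MVT_segment R f df a b ab (fun x _ => dfx x).
  apply: continuous_subspaceT => x.
  by apply: differentiable_continuous; apply/derivable1_diffP; exact: ex_derive.
by rewrite in_itv /= => cab ->; exists c.
Qed.

(** The cumulant generating function [L] of a Bernoulli variable has derivative [q], the success
    probability after exponential tilting, and [q' = q (1 - q) <= 1 / 4]; two applications of the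
    mean value theorem integrate this bound. *)
Lemma bernoulli_mgf_le (R : realType) (p u : R) : 0 <= p <= 1 -> 0 <= u ->
  1 - p + p * expR u <= expR (p * u + u ^+ 2 / 8).
Proof.
move=> /andP[p0 p1] u0.
pose D v : R := 1 - p + p * expR v.
have D_gt0 v : 0 < D v.
  rewrite /D; have := expR_gt0 v; have [->|pn0] := eqVneq p 0.
    by rewrite subr0 mul0r addr0.
  by move=> e0; rewrite ltr_wpDl ?subr_ge0// mulr_gt0// lt_neqAle eq_sym pn0.
pose L v : R := ln (D v).
(* Writing the tilted probability through [L] lets its derivative follow from [L' = q] by the chain
   rule, with no quotient to differentiate. *)
pose q v : R := p * expR (v - L v).
have qE v : q v = p * expR v / D v by rewrite /q expRD expRN lnK ?posrE// mulrA.
have dL v : is_derive v (1 : R) L (q v).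
  have dD : is_derive v (1 : R) D (p * expR v).
    rewrite (_ : D = cst (1 - p) + p \*: expR)//.
    by apply: is_derive_eq; rewrite add0r.
  have := is_derive1_ln (D_gt0 v) => dln.
  by apply: is_derive_eq; rewrite qE mulrC.
have dq v : is_derive v (1 : R) q (q v * (1 - q v)).
  have dvL : is_derive v (1 : R) (fun w => w - L w) (1 - q v).
    by rewrite (_ : (fun _ => _) = id - L)//; exact: is_deriveB.
  have dexp : is_derive v (1 : R) (expR \o (fun w => w - L w))
      (expR (v - L v) * (1 - q v)).
    by have := is_derive_expR (v - L v) => h; apply: is_derive_eq; rewrite mulrC.
  rewrite (_ : q = p \*: (expR \o (fun w => w - L w)))//.
  by apply: is_derive_eq; rewrite /q /GRing.scale /= mulrA.
have q0 : q 0 = p by rewrite qE /D expR0 !mulr1 subrK divr1.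
have q_le v : 0 <= v -> q v <= p + v / 4.
  move=> v0; have [c _] := mean_value v0 dq; rewrite q0 subr0 => h.
  rewrite -lerBlDl h mulrC; apply: ler_wpM2l => //; rewrite -subr_ge0.
  rewrite (_ : _ - _ = (q c - 1 / 2) ^+ 2) ?sqr_ge0//.
  by move: (q c) => x; field.
(* [psi] vanishes at [0] and has nonnegative derivative on [v >= 0] by [q_le]. *)
pose psi v : R := p * v + v ^+ 2 / 8 - L v.
have dpsi v : is_derive v (1 : R) psi (p + v / 4 - q v).
  rewrite (_ : psi = p \*: id + 8^-1 \*: (id : R -> R) ^+ 2 - L); last first.
    by apply/funext => w; rewrite /psi !fctE /= /GRing.scale/= [_ / 8]mulrC.
  by apply: is_derive_eq; rewrite /GRing.scale /=; congr (_ - _); clear; lra.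
have [c /andP[c0 _]] := mean_value u0 dpsi.
have -> : psi 0 = 0.
  by rewrite /psi /L /D expR0 mulr1 subrK ln1 expr0n /= mulr0 mul0r !addr0 subr0.
rewrite !subr0 => h.
have : 0 <= psi u by rewrite h mulr_ge0// subr_ge0 q_le.
by rewrite /psi subr_ge0 => Lu; rewrite -[leLHS](lnK (D_gt0 u)) ler_expR.
Qed.

(** The tangent at [u * t], evaluated at [u] and at [0], lies below the exponential; weighting the
    two inequalities by [t] and [1 - t] cancels the linear terms. *)
Lemma expR_chord (R : realType) (u t : R) : 0 <= t <= 1 ->
  expR (u * t) <= 1 + (expR u - 1) * t.
Proof.
move=> /andP[t0 t1].
have h1 : expR (u * t) * (1 + (u - u * t)) <= expR u.
  rewrite -[in leRHS](subrK (u * t) u) expRD mulrC ler_wpM2r ?expR_ge0//.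
  exact: expR_ge1Dx.
have h2 : expR (u * t) * (1 - u * t) <= 1.
  rewrite -[leRHS](expRxMexpNx_1 (u * t)) ler_wpM2l ?expR_ge0//.
  exact: expR_ge1Dx.
have h3 := ler_wpM2l t0 h1; have t1' : 0 <= 1 - t by rewrite subr_ge0.
by have := ler_wpM2l t1' h2; lra.
Qed.

Section hoeffding.
Context {disp : measure_display} {T : measurableType disp} {R : realType}.
Context (P : probability T R).

(* Convexity of the exponential bounds [expR (u * f)] by its chord, which reduces the claim
   to a Bernoulli variable. *)
Lemma hoeffding_mgf01 (f : T -> R) (u : R) : measurable_fun setT f ->
  (forall x, 0 <= f x <= 1) -> 0 <= u ->
  \int[P]_x expR (u * f x) <= expR (u * \int[P]_x f x + u ^+ 2 / 8).
Proof.
move=> mf f01 u0.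
have bf : bounded_mfun f.
  by split => //; exists 1 => x; have /andP[? ?] := f01 x; rewrite ger0_norm.
have p0 : 0 <= \int[P]_x f x <= 1.
  apply/andP; split.
    by apply: Rintegral_ge_cst => // x; have /andP[] := f01 x.
  by apply: Rintegral_le_cst => // x; have /andP[] := f01 x.
rewrite [u * \int[P]_x f x]mulrC; apply: le_trans (bernoulli_mgf_le p0 u0).
have -> : 1 - \int[P]_x f x + \int[P]_x f x * expR u =
    \int[P]_x (1 + (expR u - 1) * f x).
  rewrite RintegralD_bounded ?Rintegral_prob_cst ?RintegralZl_bounded//.
  - by ring.
  - exact: bounded_mfun_cst.
  - by apply: bounded_mfunM => //; exact: bounded_mfun_cst.
apply: le_Rintegral_bounded.
- by apply: bounded_mfun_expR; apply: bounded_mfunM => //; exact: bounded_mfun_cst.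
- apply: bounded_mfunD; first exact: bounded_mfun_cst.
  by apply: bounded_mfunM => //; exact: bounded_mfun_cst.
move=> x; exact: expR_chord.
Qed.

End hoeffding.

Section chernoff_bound.
Context {disp : measure_display} {T : measurableType disp} {R : realType}.

Lemma measurable_set_gt (f : T -> R) (t : R) : measurable_fun setT f ->
  measurable [set x | t < f x].
Proof.
move=> mf; have := mf measurableT _ (@measurable_itv R `]t, +oo[).
rewrite setTI (_ : f @^-1` _ = [set x | t < f x])//.
by apply/seteqP; split => x /=; rewrite in_itv/= andbT.
Qed.

(** Markov's inequality for [expR (f x)]; the Chernoff parameter is meant to be absorbed into [f]
    and [t]. *)
Lemma prob_gt_le_of_mgf (P : probability T R) (f : T -> R) (t K : R) :
  bounded_mfun f -> \int[P]_x expR (f x) <= K ->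
  (P [set x | (t < f x)%R] <= (K * expR (- t))%:E)%E.
Proof.
move=> bf fK; have mf := bf.1.
have mA := measurable_set_gt t mf.
have be : bounded_mfun (fun x => expR (f x)) by exact: bounded_mfun_expR.
rewrite -(@fineK _ (P _)) ?fin_num_measure// lee_fin expRN ler_pdivlMr ?expR_gt0//.
apply: le_trans fK.
have bI : bounded_mfun (\1_[set x | t < f x] : T -> R).
  split => //; exists 1 => x; rewrite indicE; case: (_ \in _); by rewrite ?normr1 ?normr0.
have -> : fine (P [set x | t < f x]) = \int[P]_x (\1_[set x | t < f x] x : R).
  by rewrite /Rintegral integral_indic// setIT.
rewrite mulrC -RintegralZl_bounded//; apply: le_Rintegral_bounded => //.
  by apply: bounded_mfunM => //; exact: bounded_mfun_cst.
move=> x; rewrite indicE; have [/[!inE] /= h|_] := boolP (x \in _).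
  by rewrite mulr1 ler_expR ltW.
by rewrite mulr0 expR_ge0.
Qed.

End chernoff_bound.

Section mcdiarmid.
Context {disp : measure_display} {T : measurableType disp} {R : realType}.

(** Only the oscillation of [f] is controlled, so [f] is rescaled to [[0, 1]] from its infimum
    before applying the lemma for that range. *)
Lemma hoeffding_mgf (P : probability T R) (f : T -> R) (c l : R) :
  measurable_fun setT f -> (forall x y, f x - f y <= c) -> 0 <= l ->
  \int[P]_x expR (l * f x) <= expR (l * \int[P]_x f x + (l * c) ^+ 2 / 8).
Proof.
move=> mf fc l0.
have c0 : 0 <= c by have := fc point point; rewrite subrr.
have hi : has_inf (range f).
  split; first by exists (f point), point.
  by exists (f point - c) => _ [x _ <-]; have := fc point x; lra.
pose a := inf (range f).
have af x : a <= f x by apply: ge_inf; [exact: hi.2|exists x].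
have fa x : f x <= a + c.
  rewrite -lerBlDr; apply: lb_le_inf; first exact: hi.1.
  by move=> _ [y _ <-]; have := fc x y; lra.
have bf : bounded_mfun f.
  split => //; exists (`|a| + `|c|) => x; rewrite ler_norml; apply/andP; split.
    apply: le_trans (af x); rewrite -[leRHS]opprK lerN2.
    by rewrite -normrN (le_trans (ler_norm _))// lerDl.
  by apply: le_trans (fa x) _; apply: lerD; exact: ler_norm.
(* The rescaling divides by [c]; oscillation [0] means that [f] is constant. *)
have [c_eq0|c_neq0] := eqVneq c 0.
  have fE x : f x = a.
    by apply/eqP; rewrite eq_le af andbT; have := fa x; rewrite c_eq0 addr0.
  rewrite (@eq_Rintegral _ _ _ _ _ (fun=> expR (l * a))) => [|x _]; last first.
    by rewrite fE.
  rewrite [in leRHS](@eq_Rintegral _ _ _ _ _ (fun=> a)) => [|x _]; last first.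
    by rewrite fE.
  by rewrite !Rintegral_prob_cst ler_expR c_eq0 mulr0 expr0n mul0r addr0.
have c_gt0 : 0 < c by rewrite lt_neqAle eq_sym c_neq0.
pose g x := c^-1 * (f x - a).
have bg : bounded_mfun g.
  apply: bounded_mfunM; first exact: bounded_mfun_cst.
  by apply: bounded_mfunB => //; exact: bounded_mfun_cst.
have g01 x : 0 <= g x <= 1.
  rewrite /g mulr_ge0 ?invr_ge0 ?subr_ge0//=.
  by rewrite mulrC ler_pdivrMr// mul1r lerBlDl.
have lfE x : l * f x = l * a + l * c * g x.
  by rewrite /g mulrA mulfK//; ring.
have ifE : \int[P]_x f x = a + c * \int[P]_x g x.
  rewrite -RintegralZl_bounded// -[X in X + _](Rintegral_prob_cst P).
  rewrite -RintegralD_bounded.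
  - by apply: eq_Rintegral => x _; rewrite /g mulrA mulfV// mul1r addrC subrK.
  - exact: bounded_mfun_cst.
  - by apply: bounded_mfunM => //; exact: bounded_mfun_cst.
rewrite (@eq_Rintegral _ _ _ _ _ (fun x => expR (l * a) * expR (l * c * g x)));
  last by move=> x _; rewrite lfE expRD.
rewrite RintegralZl_bounded; last first.
  by apply/bounded_mfun_expR/bounded_mfunM => //; exact: bounded_mfun_cst.
apply: le_trans (ler_wpM2l (expR_ge0 _) (hoeffding_mgf01 P bg.1 g01 _)) _.
  exact: mulr_ge0.
by rewrite -expRD ler_expR ifE; lra.
Qed.

(** A one-sided bound suffices, since [S] and [S'] can be exchanged. *)
Definition bounded_differences n (f : n.-tuple T -> R) (c : R) : Prop :=
  forall (i : 'I_n) S S', (forall j, j != i -> tnth S j = tnth S' j) ->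
    f S - f S' <= c.

(** Induction on [n] takes the place of a martingale. With the first observation fixed, the
    induction hypothesis handles the others; the resulting conditional mean [F] again oscillates by
    at most [c], and Hoeffding's lemma handles the first. *)
Lemma mcdiarmid_mgf (D : probability T R) n (f : n.-tuple T -> R) (c l : R) :
  bounded_mfun f -> bounded_differences f c -> 0 <= l ->
  \int[power_prob D n]_S expR (l * f S) <=
  expR (l * \int[power_prob D n]_S f S + n%:R * (l * c) ^+ 2 / 8).
Proof.
move=> bf fc l0; elim: n f bf fc => [|n IH] f bf fc.
  by rewrite !Rintegral_power_prob0 !mul0r addr0.
have be : bounded_mfun (fun S => expR (l * f S)).
  by apply/bounded_mfun_expR/bounded_mfunM => //; exact: bounded_mfun_cst.
rewrite !Rintegral_power_probS//.
have bfc := bounded_mfun_cons bf.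
pose F x := \int[power_prob D n]_S f (Defs.cons_tuple (x, S)).
have bF : bounded_mfun F := bounded_mfun_Rintegral2 D (power_prob D n) bfc.
have bel : bounded_mfun (fun x => expR (l * F x)).
  by apply/bounded_mfun_expR/bounded_mfunM => //; exact: bounded_mfun_cst.
apply: (@le_trans _ _ (\int[D]_x
    (expR (n%:R * (l * c) ^+ 2 / 8) * expR (l * F x)))).
  apply: le_Rintegral_bounded.
  - exact: (bounded_mfun_Rintegral2 D (power_prob D n) (bounded_mfun_cons be)).
  - by apply: bounded_mfunM => //; exact: bounded_mfun_cst.
  move=> x; apply: le_trans (IH _ (bounded_mfun_section2 bfc x) _) _.
  - move=> i S S' SS'; apply: (fc (lift ord0 i)) => j.
    have [k ->|->] := unliftP ord0 j; last by rewrite !tnth0.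
    by rewrite (inj_eq lift_inj) !tnthS; exact: SS'.
  - by rewrite -expRD ler_expR addrC.
rewrite RintegralZl_bounded//.
apply: le_trans (ler_wpM2l (expR_ge0 _) (hoeffding_mgf D (c := c) bF.1 _ l0)) _.
  move=> x y; rewrite /F.
  have bx := bounded_mfun_section2 bfc x; have by_ := bounded_mfun_section2 bfc y.
  rewrite -RintegralB_bounded//; apply: Rintegral_le_cst.
    exact: bounded_mfunB.
  move=> S; apply: (fc ord0) => j; have [k ->|->] := unliftP ord0 j.
    by rewrite !tnthS.
  by rewrite eqxx.
by rewrite -expRD ler_expR -natr1; lra.
Qed.

Lemma mcdiarmid (D : probability T R) n (f : n.-tuple T -> R) (c dl : R) :
  (0 < n)%N -> 0 < c -> 0 < dl <= 1 ->
  bounded_mfun f -> bounded_differences f c ->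
  (power_prob D n [set S | (\int[power_prob D n]_S f S +
     c * Num.sqrt (n%:R * ln (dl^-1) / 2) < f S)%R]
   <= dl%:E)%E.
Proof.
move=> n0 c0 /andP[dl0 dl1] bf fc.
set m := \int[_]_S _; set s := Num.sqrt _.
have n0' : (0 : R) < n%:R by rewrite ltr0n.
have ln0 : 0 <= ln dl^-1 by rewrite ln_ge0// invf_ge1.
have s0 : 0 <= s by exact: sqrtr_ge0.
have s2 : s ^+ 2 = n%:R * ln dl^-1 / 2.
  by rewrite sqr_sqrtr// mulr_ge0// mulr_ge0// ltW.
(* The minimizer of the Chernoff exponent [- l c s + n (l c)^2 / 8], with minimum
   [- 2 s^2 / n = ln dl]. *)
pose l := 4 * s / (n%:R * c).
have l0 : 0 <= l by rewrite divr_ge0 ?mulr_ge0// ltW.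
(* Here [l] would be [0], but then [dl = 1] and the claim is trivial. *)
have [s_eq0|s_neq0] := eqVneq s 0.
  have -> : dl = 1.
    apply/eqP; rewrite eq_le dl1 /=.
    have /eqP : ln dl^-1 = 0.
      move: s2; rewrite s_eq0 expr0n /= => /esym/eqP.
      by rewrite !mulf_eq0 (gt_eqF n0') invr_eq0 pnatr_eq0 /= orbF => /eqP.
    by rewrite ln_eq0 ?invr_gt0// invr_eq1 => /eqP ->.
  by apply: probability_le1; apply: measurable_set_gt; case: bf.
have l_gt0 : 0 < l.
  by rewrite divr_gt0 ?mulr_gt0// lt_neqAle eq_sym s_neq0.
have blf : bounded_mfun (fun S => l * f S).
  by apply: bounded_mfunM => //; exact: bounded_mfun_cst.
have := @prob_gt_le_of_mgf _ _ _ (power_prob D n) (fun S => l * f S)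
  (l * (m + c * s)) _ blf (mcdiarmid_mgf D bf fc l0).
rewrite (_ : [set x | l * (m + c * s) < l * f x] = [set S | m + c * s < f S]); last first.
  by apply/seteqP; split => S /=; rewrite ltr_pM2l.
move=> /le_trans; apply; rewrite lee_fin -expRD -[leRHS](lnK dl0) ler_expR.
have -> : ln dl = - (2 * s ^+ 2 / n%:R).
  by rewrite s2 lnV ?posrE//; field; rewrite gt_eqF.
rewrite le_eqVlt; apply/orP; left; apply/eqP; rewrite -/m /l.
by field; rewrite !gt_eqF.
Qed.

End mcdiarmid.

(** * Gaussian integrals *)

Section gaussian_integral.
Context {R : realType}.
Notation mu := (@lebesgue_measure R).
Implicit Types (m s : R).

(** The Radon-Nikodym derivative and [normal_pdf] have the same integral over every measurable set,
    hence agree almost everywhere. *)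
Lemma ge0_integral_normal_prob m s (f : R -> \bar R) :
  measurable_fun setT f -> (forall x, 0 <= f x)%E ->
  (\int[normal_prob m s]_x f x = \int[mu]_x (f x * (normal_pdf m s x)%:E))%E.
Proof.
move=> mf f0; have dom := normal_prob_dominates m s.
rewrite -(Radon_Nikodym_SigmaFinite.change_of_variables dom f0 measurableT mf).
have ig := Radon_Nikodym_SigmaFinite.f_integrable dom.
have mg := measurable_int _ ig.
have mpdf : measurable_fun setT (fun x => (normal_pdf m s x)%:E).
  by apply/measurable_EFinP; exact: measurable_normal_pdf.
have ge0 x := Radon_Nikodym_SigmaFinite.f_ge0 dom x.
apply: ge0_ae_eq_integral => //.
- exact: emeasurable_funM.
- exact: emeasurable_funM.
- by move=> x _; rewrite mule_ge0.
- by move=> x _; rewrite mule_ge0// lee_fin normal_pdf_ge0.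
apply: ae_eqe_mul2l; apply: integral_ae_eq => // E _ mE.
by rewrite -(Radon_Nikodym_SigmaFinite.f_integral dom).
Qed.

(** The translate of Lebesgue measure agrees with it on half-open intervals, and these determine
    it. *)
Lemma ge0_integral_translation (b : R) (f : R -> \bar R) :
  measurable_fun setT f -> (forall x, 0 <= f x)%E ->
  (\int[mu]_x f (x + b)%R = \int[mu]_x f x)%E.
Proof.
move=> mf f0.
pose sh (x : measurableTypeR R) : measurableTypeR R := x + b.
have msh : measurable_fun setT sh by exact: measurable_funD.
rewrite [RHS](eq_measure_integral (pushforward mu sh)); last first.
  move=> A mA _; apply: lebesgue_measure_unique => // _ [[u v]] _ <-.
  transitivity (mu `]u - b, v - b]%classic).
    rewrite !lebesgue_measure_itv/= !lte_fin ltrD2r; case: ifPn => // _.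
    by congr EFin; ring.
  rewrite /= /pushforward; congr (mu _).
  by apply/seteqP; split => x /=; rewrite !in_itv/= /sh ltrBlDr lerBrDr.
by rewrite ge0_integral_pushforward.
Qed.

(** One-dimensional Cameron-Martin formula: after translating the variable by [b], the exponential
    is the ratio of the densities at [x + b] and at [x]. *)
Lemma normal_prob_shift s (b : R) (f : R -> \bar R) : 0 < s ->
  measurable_fun setT f -> (forall x, 0 <= f x)%E ->
  (\int[normal_prob 0 s]_x f x = \int[normal_prob 0 s]_x
     (f (x + b)%R * (expR (- (b * x) / s ^+ 2 - b ^+ 2 / (2 * s ^+ 2)))%:E))%E.
Proof.
move=> s0 mf f0; have sn0 : s != 0 by rewrite gt_eqF.
have mfb : measurable_fun setT (fun x : R => f (x + b)).
  by apply: measurableT_comp => //; exact: measurable_funD.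
have me : measurable_fun setT
    (fun x : R => (expR (- (b * x) / s ^+ 2 - b ^+ 2 / (2 * s ^+ 2)))%:E).
  apply/measurable_EFinP/measurableT_comp => //.
  apply: measurable_funB => //; apply: measurable_funM => //.
  exact/measurable_funN/measurable_funM.
rewrite !ge0_integral_normal_prob//; last 2 first.
- exact: emeasurable_funM.
- by move=> x; rewrite mule_ge0// lee_fin expR_ge0.
rewrite -(ge0_integral_translation b); last 2 first.
- apply: emeasurable_funM => //.
  by apply/measurable_EFinP; exact: measurable_normal_pdf.
- by move=> x; rewrite mule_ge0// lee_fin normal_pdf_ge0.
apply: eq_integral => x _; rewrite -muleA -EFinM; congr (_ * _%:E)%E.
rewrite !normal_pdfE// /normal_fun mulrCA -expRD; congr (_ * expR _).
by rewrite !subr0; field.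
Qed.

(* With [1/t^2 = 1/s^2 - 2 b], the integrand is [t/s] times the density of N(0, t^2). *)
Lemma normal_prob_expR_sqr s (b : R) : 0 < s -> 2 * b * s ^+ 2 < 1 ->
  (\int[normal_prob 0 s]_x (expR (b * x ^+ 2))%:E =
   (Num.sqrt (1 - 2 * b * s ^+ 2))^-1%:E)%E.
Proof.
move=> s0 bs; have sn0 : s != 0 by rewrite gt_eqF.
set k := 1 - _; have k0 : 0 < k by rewrite subr_gt0.
have sk0 : 0 < Num.sqrt k by rewrite sqrtr_gt0.
have me : measurable_fun setT (fun x : R => (expR (b * x ^+ 2))%:E).
  apply/measurable_EFinP/measurableT_comp => //.
  by apply: measurable_funM => //; exact: measurable_funX.
rewrite ge0_integral_normal_prob//.
pose t := s / Num.sqrt k; have t0 : 0 < t by rewrite divr_gt0.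
have tn0 : t != 0 by rewrite gt_eqF.
transitivity (\int[mu]_x ((Num.sqrt k)^-1%:E * (normal_pdf 0 t x)%:E))%E; last first.
  rewrite ge0_integralZl//.
  - by rewrite integral_normal_pdf mule1.
  - by apply/measurable_EFinP; exact: measurable_normal_pdf.
  - by move=> x _; rewrite lee_fin normal_pdf_ge0.
apply: eq_integral => x _; rewrite -!EFinM; congr EFin; rewrite !normal_pdfE//.
rewrite /normal_peak /normal_fun !subr0.
have t2 : t ^+ 2 = s ^+ 2 / k by rewrite expr_div_n sqr_sqrtr ?ltW.
have -> : Num.sqrt (s ^+ 2 * pi *+ 2) = Num.sqrt k * Num.sqrt (t ^+ 2 * pi *+ 2).
  rewrite -sqrtrM ?ltW// t2; congr Num.sqrt.
  by rewrite -!mulrnAr mulrA [k * _]mulrC divfK// gt_eqF.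
rewrite invfM mulrCA -!mulrA; congr (_ * (_ * _)); rewrite -expRD; congr expR.
have kn0 : k != 0 by rewrite gt_eqF.
rewrite t2 /k; move: kn0; rewrite /k => kn0; field.
by rewrite sn0 /= kn0.
Qed.

End gaussian_integral.

Lemma ge0_integral_power_prob_expR_sum disp (T : measurableType disp)
    (R : realType) (D : probability T R) n (g : T -> R) (c : R) :
  measurable_fun setT g -> (\int[D]_x (expR (g x))%:E = c%:E)%E ->
  (\int[power_prob D n]_S (expR (\sum_(i < n) g (tnth S i)))%:E = (c ^+ n)%:E)%E.
Proof.
move=> mg gc.
have mge : measurable_fun setT (fun x => (expR (g x))%:E).
  by apply/measurable_EFinP; exact: measurableT_comp.
have mS k : measurable_fun setT
    (fun S : k.-tuple T => (expR (\sum_(i < k) g (tnth S i)))%:E).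
  apply/measurable_EFinP; apply: measurableT_comp => //.
  apply: measurable_sum => i; apply: measurableT_comp => //.
  exact: measurable_tnth.
elim: n => [|n IH].
  under eq_integral do rewrite big_ord0 expR0.
  by rewrite integral_cst//= diracT mule1 expr0.
rewrite ge0_integral_power_probS//.
under eq_integral.
  move=> x _; under eq_integral.
    move=> S _; rewrite big_ord_recl tnth0 expRD EFinM.
    under eq_bigr do rewrite tnthS.
    rewrite /=; over.
  rewrite ge0_integralZl//.
  rewrite IH; over.
  exact: mS.
have c0 : (0 <= c%:E)%E.
  by rewrite -gc; apply: integral_ge0 => x _; rewrite lee_fin expR_ge0.
rewrite /= ge0_integralZr//; last by rewrite lee_fin exprn_ge0// -lee_fin.
by rewrite gc -EFinM exprS.
Qed.

Section gaussian_vector.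
Context {R : realType}.

(** Carries N(0, s^2 I) to N(w, s^2 I). The posterior appears only through this shift under
    integrals against the prior, never as a measure of its own. *)
Definition tuple_shift d (w : 'rV[R]_d) (t : d.-tuple (measurableTypeR R)) :
    d.-tuple (measurableTypeR R) :=
  [tuple w ord0 i + tnth t i | i < d].

Lemma measurable_tuple_shift d (w : 'rV[R]_d) :
  measurable_fun setT (tuple_shift w).
Proof.
apply/measurable_fun_tnthP => i.
rewrite (_ : _ \o _ = fun t => w ord0 i + tnth t i); last first.
  by apply/funext => t; rewrite /= tnth_mktuple.
by apply: measurable_funD => //; exact: measurable_tnth.
Qed.

Lemma row_of_tuple_shift d (w : 'rV[R]_d) t :
  row_of_tuple (tuple_shift w t) = w + row_of_tuple t.
Proof. by apply/rowP => i; rewrite !mxE tnth_mktuple. Qed.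

Lemma measurable_dotp_row_of_tuple d (w : 'rV[R]_d) :
  measurable_fun setT (fun t => dotp w (row_of_tuple t) : R).
Proof.
rewrite /dotp; apply: measurable_sum => i.
under eq_fun do rewrite mxE.
by apply: measurable_funM => //; exact: measurable_tnth.
Qed.

Let cameron_martin d (s : R) (w : 'rV[R]_d) (t : d.-tuple (measurableTypeR R)) : R :=
  expR (- dotp w (row_of_tuple t) / s ^+ 2 - dotp w w / (2 * s ^+ 2)).

Let measurable_cameron_martin d (s : R) (w : 'rV[R]_d) :
  measurable_fun setT (fun t => (cameron_martin s w t)%:E).
Proof.
apply/measurable_EFinP/measurableT_comp => //; apply: measurable_funB => //.
apply: measurable_funM => //; apply: measurable_funN.
exact: measurable_dotp_row_of_tuple.
Qed.

(** Cameron-Martin in dimension [d]. The weight factors over coordinates, so the induction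
    hypothesis shifts the tail by [w'] and the one-dimensional formula shifts the first
    coordinate. *)
Lemma gaussian_shift d (s : R) (w : 'rV[R]_d)
    (f : d.-tuple (measurableTypeR R) -> \bar R) : 0 < s ->
  measurable_fun setT f -> (forall t, 0 <= f t)%E ->
  (\int[power_prob (normal_prob 0 s) d]_t f t =
   \int[power_prob (normal_prob 0 s) d]_t (f (tuple_shift w t) *
     (expR (- dotp w (row_of_tuple t) / s ^+ 2 - dotp w w / (2 * s ^+ 2)))%:E))%E.
Proof.
move=> s0; elim: d => [|d IH] in w f *.
  move=> mf f0; apply: eq_integral => t _.
  rewrite /cameron_martin /dotp !big_ord0 oppr0 !mul0r subr0 expR0 mule1.
  by congr f; apply: eq_from_tnth => -[].
move=> mf f0; pose w' : 'rV[R]_d := \row_i w ord0 (lift ord0 i).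
have shiftE a t : tuple_shift w (Defs.cons_tuple (a, t)) =
    Defs.cons_tuple (a + w ord0 ord0, tuple_shift w' t).
  apply: eq_from_tnth => i; rewrite tnth_mktuple.
  have [j ->|->] := unliftP ord0 i; last by rewrite !tnth0 addrC.
  by rewrite !tnthS tnth_mktuple mxE.
have cmE a t : cameron_martin s w (Defs.cons_tuple (a, t)) =
    expR (- (w ord0 ord0 * a) / s ^+ 2 - w ord0 ord0 ^+ 2 / (2 * s ^+ 2)) *
    cameron_martin s w' t.
  rewrite /cameron_martin -expRD; congr expR.
  have -> : dotp w (row_of_tuple (Defs.cons_tuple (a, t))) =
      w ord0 ord0 * a + dotp w' (row_of_tuple t).
    rewrite /dotp big_ord_recl mxE tnth0; congr (_ + _).
    by apply: eq_bigr => i _; rewrite !mxE tnthS.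
  have -> : dotp w w = w ord0 ord0 ^+ 2 + dotp w' w'.
    rewrite /dotp big_ord_recl expr2; congr (_ + _).
    by apply: eq_bigr => i _; rewrite !mxE.
  by field; rewrite gt_eqF.
pose F a := (\int[power_prob (normal_prob 0 s) d]_t
  (f (Defs.cons_tuple (a, tuple_shift w' t)) * (cameron_martin s w' t)%:E))%E.
have mcm0 k v : forall t, (0 <= (@cameron_martin k s v t)%:E)%E.
  by move=> t; rewrite lee_fin expR_ge0.
have mfc : measurable_fun setT (fun p : measurableTypeR R * d.-tuple (measurableTypeR R) =>
    f (Defs.cons_tuple (p.1, tuple_shift w' p.2)) * (cameron_martin s w' p.2)%:E)%E.
  apply: emeasurable_funM; last exact: (measurableT_comp (measurable_cameron_martin s w')).
  apply: measurableT_comp => //; apply: measurableT_comp => //.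
  apply/measurable_fun_pair => //.
  exact: (measurableT_comp (measurable_tuple_shift w')).
have mF : measurable_fun setT F.
  apply: (measurable_fun_fubini_tonelli_F _ mfc).
  by move=> p; rewrite mule_ge0.
have F0 a : (0 <= F a)%E by apply: integral_ge0 => t _; rewrite mule_ge0.
rewrite !ge0_integral_power_probS//; last 2 first.
- apply: emeasurable_funM; last exact: measurable_cameron_martin.
  by apply: measurableT_comp => //; exact: measurable_tuple_shift.
- by move=> t; apply: mule_ge0; rewrite ?f0 ?lee_fin ?expR_ge0.
transitivity (\int[normal_prob 0 s]_a F a)%E.
  apply: eq_integral => a _; rewrite (IH w')//.
  by apply: measurableT_comp => //; apply: measurableT_comp => //; exact: measurable_fun_pair.
rewrite (normal_prob_shift (w ord0 ord0) s0 mF F0).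
apply: eq_integral => a _; rewrite -ge0_integralZr//.
- apply: eq_integral => t _; rewrite shiftE.
  rewrite -[X in _ = (_ * X%:E)%E]/(cameron_martin s w (Defs.cons_tuple (a, t))).
  by rewrite cmE EFinM [((expR _)%:E * _)%E]muleC muleA.
- exact: (measurableT_comp mfc (pair1_measurable _)).
- by move=> t _; rewrite mule_ge0.
Qed.

End gaussian_vector.

Section euclidean.
Context {R : realType} {d : nat}.
Implicit Types u v w : 'rV[R]_d.

Lemma dotpC u v : dotp u v = dotp v u.
Proof. by apply: eq_bigr => i _; rewrite mulrC. Qed.

Lemma dotpDl u v w : dotp (u + v) w = dotp u w + dotp v w.
Proof. by rewrite /dotp -big_split; apply: eq_bigr => i _; rewrite !mxE mulrDl. Qed.

Lemma dotpZl (c : R) u w : dotp (c *: u) w = c * dotp u w.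
Proof. by rewrite /dotp mulr_sumr; apply: eq_bigr => i _; rewrite !mxE mulrA. Qed.

Lemma dotpDr u v w : dotp w (u + v) = dotp w u + dotp w v.
Proof. by rewrite !(dotpC w) dotpDl. Qed.

Lemma dotpZr (c : R) u w : dotp w (c *: u) = c * dotp w u.
Proof. by rewrite !(dotpC w) dotpZl. Qed.

Lemma dotpNl u w : dotp (- u) w = - dotp u w.
Proof. by rewrite -scaleN1r dotpZl mulN1r. Qed.

Lemma dotpNr u w : dotp w (- u) = - dotp w u.
Proof. by rewrite !(dotpC w) dotpNl. Qed.

Lemma dotp_ge0 u : 0 <= dotp u u.
Proof. by apply: sumr_ge0 => i _; rewrite -expr2 sqr_ge0. Qed.

Lemma enorm_ge0 u : 0 <= enorm u.
Proof. exact: sqrtr_ge0. Qed.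

Lemma enorm_sqr u : enorm u ^+ 2 = dotp u u.
Proof. by rewrite sqr_sqrtr// dotp_ge0. Qed.

Lemma enorm_eq0 u : enorm u = 0 -> u = 0.
Proof.
move=> u0; have /eqP : dotp u u = 0 by rewrite -enorm_sqr u0 expr0n.
rewrite /dotp psumr_eq0; last by move=> i _; rewrite -expr2 sqr_ge0.
move=> /allP h; apply/rowP => i; rewrite mxE; apply/eqP.
by have := h i (mem_index_enum _); rewrite -expr2 sqrf_eq0.
Qed.

Lemma dotp0 u : dotp u 0 = 0.
Proof. by rewrite /dotp big1// => i _; rewrite mxE mulr0. Qed.

(** Cauchy-Schwarz, from the nonnegative square of [enorm v *: u - enorm u *: v], which expands to
    [2 x y (x y - z)]; the degenerate cases come first so that [x * y] can be cancelled. *)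
Lemma dotp_le_enorm u v : dotp u v <= enorm u * enorm v.
Proof.
have [v0|v0] := eqVneq (enorm v) 0.
  by rewrite v0 mulr0 (enorm_eq0 v0) dotp0.
have v_gt0 : 0 < enorm v by rewrite lt_neqAle eq_sym v0 enorm_ge0.
have [u0|u_neq0] := eqVneq (enorm u) 0.
  by rewrite u0 mul0r (enorm_eq0 u0) dotpC dotp0.
have u_gt0 : 0 < enorm u by rewrite lt_neqAle eq_sym u_neq0 enorm_ge0.
have := dotp_ge0 (enorm v *: u - enorm u *: v).
rewrite !(dotpDl, dotpDr, dotpNl, dotpNr, dotpZl, dotpZr) -!enorm_sqr (dotpC v u).
set x := enorm u; set y := enorm v; set z := dotp u v => h.
have xy : 0 < x * y by rewrite mulr_gt0.
rewrite -(ler_pM2l xy); move: h; rewrite -subr_ge0 => h; rewrite -subr_ge0.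
rewrite -(pmulr_rge0 _ (ltr0Sn R 1)); apply: le_trans h _.
by rewrite le_eqVlt; apply/orP; left; apply/eqP; rewrite subr0; ring.
Qed.

Lemma normr_dotp_le u v : `|dotp u v| <= enorm u * enorm v.
Proof.
rewrite ler_norml dotp_le_enorm andbT -[leRHS]opprK -dotpNl lerN2.
suff -> : enorm u = enorm (- u) by exact: dotp_le_enorm.
by rewrite /enorm dotpNl dotpNr opprK.
Qed.

End euclidean.

(** * Moments of a linear form of a Gaussian vector *)

Section gaussian_moments.
Context {R : realType}.

(* Replacing [a] by [e *: a] for small [e] turns the moment generating function into bounds
   on the first two moments, through the next two lemmas. *)
Lemma expR_first_order_le (c v : R) : 0 <= c ->
  (forall e, 0 < e -> e * v <= expR (e * c) - 1) -> v <= c.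
Proof.
move=> c0 H; apply: contrapT => /negP; rewrite -ltNge => cv.
have [c_eq0|c_neq0] := eqVneq c 0.
  have := H 1 ltr01; rewrite c_eq0 mulr0 expR0 subrr mul1r leNgt.
  by rewrite (le_lt_trans c0 cv).
have c_gt0 : 0 < c by rewrite lt_neqAle eq_sym c_neq0.
have v_gt0 : 0 < v := lt_trans c_gt0 cv.
(* The bound [expR y <= 1 / (1 - y)] at [y = e c] turns the hypothesis into [v (1 - e c) <= c]; this
   [e] makes the left side [(v + c) / 2], which exceeds [c]. *)
pose e := (v - c) / (2 * c * v).
have e0 : 0 < e by rewrite divr_gt0 ?subr_gt0// !mulr_gt0.
have ec : e * c = (v - c) / (2 * v) by rewrite /e; field; rewrite !gt_eqF.
have ec1 : 1 - e * c = (v + c) / (2 * v) by rewrite ec; field; rewrite !gt_eqF.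
have vc0 : 0 < v + c by rewrite addr_gt0.
have : expR (e * c) <= (1 - e * c)^-1.
  rewrite -[leLHS]invrK -expRN lef_pV2 ?posrE ?expR_gt0 ?expR_ge1Dx//.
  by rewrite ec1 divr_gt0// mulr_gt0.
rewrite ec1 invf_div => h; have := le_trans (H e e0) (lerB h (lexx 1)).
rewrite /e => h2.
have : (v - c) / (2 * c * v) * v * (2 * c * (v + c)) <=
    (2 * v / (v + c) - 1) * (2 * c * (v + c)).
  by apply: ler_wpM2r => //; rewrite !mulr_ge0// ltW.
rewrite (_ : (v - c) / (2 * c * v) * v * (2 * c * (v + c)) = (v - c) * (v + c)); last first.
  by field; rewrite !gt_eqF.
rewrite (_ : (2 * v / (v + c) - 1) * (2 * c * (v + c)) = (v - c) * (2 * c)); last first.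
  by field; rewrite gt_eqF.
by rewrite ler_pM2l ?subr_gt0//; move: cv; lra.
Qed.

Lemma expR_second_order_le (c v : R) : 0 <= c ->
  (forall e, 0 < e -> e * v <= expR (e ^+ 2 * c) - 1) -> v <= 0.
Proof.
move=> c0 H; apply: contrapT => /negP; rewrite -ltNge => v0.
have c1 : 0 < c + 1 by rewrite ltr_wpDl.
have v1 : 0 < v + 1 by rewrite addr_gt0.
(* Small enough that [e^2 c <= 1 / 2], hence [expR (e^2 c) - 1 <= 2 e^2 c], and that [2 e c < v],
   which makes the right side smaller than [e v]. *)
pose e := v / (2 * (c + 1) * (v + 1)).
have e0 : 0 < e by rewrite divr_gt0// !mulr_gt0.
have eE : 2 * e * (c + 1) = v / (v + 1) by rewrite /e; field; rewrite !gt_eqF.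
have vv1 : v / (v + 1) < 1 by rewrite ltr_pdivrMr// mul1r ltrDl.
have vvv : v / (v + 1) < v by rewrite ltr_pdivrMr// ltr_pMr// ltrDr.
have ec0 : 0 <= e * c by rewrite mulr_ge0// ltW.
have ecv : 2 * (e * c) < v by apply: le_lt_trans vvv; rewrite -eE; lra.
have ec1 : 2 * (e * c) < 1 by apply: le_lt_trans vv1; rewrite -eE; lra.
have e1 : 2 * e < 1 by apply: le_lt_trans vv1; rewrite -eE; lra.
have x4 : e ^+ 2 * c <= 2^-1.
  rewrite expr2 -mulrA; apply: (@le_trans _ _ (1 * (e * c))); last by lra.
  by apply: ler_wpM2r => //; lra.
have x0 : 0 <= e ^+ 2 * c by rewrite mulr_ge0// sqr_ge0.
have : expR (e ^+ 2 * c) <= 1 + 2 * (e ^+ 2 * c).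
  rewrite -[leLHS]invrK -expRN -[leRHS]invrK lef_pV2 ?posrE ?expR_gt0//; last first.
    by rewrite invr_gt0 ltr_pwDl// mulr_ge0.
  apply: le_trans (expR_ge1Dx _).
  rewrite -[leLHS]mul1r ler_pdivrMr; last by rewrite ltr_pwDl// mulr_ge0.
  by move: x4 x0; move: (e ^+ 2 * c) => x x4 x0; nra.
move=> h; have := le_trans (H e e0) (lerB h (lexx 1)).
rewrite [1 + _]addrC addrK expr2 (_ : 2 * (e * e * c) = e * (2 * (e * c))); last by ring.
by rewrite ler_pM2l// leNgt ecv.
Qed.

(** The half-angle identity writes the right side as [(expR (z / 2) - expR (- (z / 2)))^2 + 2], and
    [2 sinh u >= 2 u] for [u >= 0] because the derivative [2 cosh] is at least [2]. It lets
    exponential moments dominate squares. *)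
Lemma sqr_le_expRD (z : R) : z ^+ 2 + 2 <= expR z + expR (- z).
Proof.
have sinh_ge (u : R) : 0 <= u -> 2 * u <= expR u - expR (- u).
  move=> u0; pose f (v : R) : R := expR v - expR (- v).
  have df (v : R) : is_derive v (1 : R) f (expR v + expR (- v)).
    have dN : is_derive v (1 : R) (fun w : R => expR (- w)) (- expR (- v)).
      have h := is_derive_expR (- v).
      rewrite (_ : (fun w => expR (- w)) = expR \o -%R)//.
      by apply: is_derive_eq; rewrite mulrN1.
    rewrite (_ : f = expR - (fun w => expR (- w)))//.
    by apply: is_derive_eq; rewrite opprK.
  have [c _] := mean_value u0 df; rewrite {2}/f oppr0 expR0 subrr subr0 addr0 => h.
  rewrite -[leRHS]/(f u) h; apply: ler_wpM2r => //.
  have cc := expRxMexpNx_1 c; have p := expR_gt0 c; have q := expR_gt0 (- c).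
  have := sqr_ge0 (expR c - expR (- c)).
  move: cc p q; move: (expR c) (expR (- c)) => x y; clear; move=> cc p q h.
  have : 2 ^+ 2 <= (x + y) ^+ 2 by move: h; rewrite !expr2; lra.
  by rewrite ler_pXn2r// nnegrE// addr_ge0// ltW.
have E : expR z + expR (- z) = (expR (z / 2) - expR (- (z / 2))) ^+ 2 + 2.
  have ez (x : R) : expR x = expR (x / 2) ^+ 2.
    by rewrite -expRM_natl mulrC divfK.
  suff : expR z + expR (- z) = (expR (z / 2) - expR (- (z / 2))) ^+ 2 +
      2 * (expR (z / 2) * expR (- (z / 2))) by rewrite expRxMexpNx_1 mulr1.
  by rewrite (ez z) (ez (- z)) mulNr; ring.
rewrite E lerD2r; have := sinh_ge `|z / 2| (normr_ge0 _).
have -> : z ^+ 2 = (2 * `|z / 2|) ^+ 2.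
  by rewrite exprMn real_normK ?num_real// expr_div_n mulrC divfK.
have [z0|z0] := ler0P (z / 2).
  rewrite opprK => h; rewrite -[X in _ <= X]sqrrN opprB.
  by rewrite ler_pXn2r// nnegrE ?(le_trans _ h)// mulr_ge0// oppr_ge0.
by move=> h; rewrite ler_pXn2r// nnegrE ?(le_trans _ h)// mulr_ge0// ltW.
Qed.

Context (d : nat) (s : R) (s0 : 0 < s).
Notation N := (power_prob (@normal_prob R 0 s) d).
Implicit Types a : 'rV[R]_d.

(** For the shift by [- s^2 a] the Cameron-Martin weight is [expR (dotp a t - s^2 |a|^2 / 2)]; since
    the constant [1] integrates to [1], so does this weight. *)
Lemma gaussian_mgf a :
  (\int[N]_t (expR (dotp a (row_of_tuple t)))%:E =
   (expR (s ^+ 2 * dotp a a / 2))%:E)%E.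
Proof.
have := @gaussian_shift R d s (- s ^+ 2 *: a) (cst 1%E) s0 (measurable_cst _)
  (fun=> lee01).
rewrite integral_cst//= probability_setT mule1 => h.
transitivity ((expR (s ^+ 2 * dotp a a / 2))%:E *
    \int[N]_t (cst 1 (tuple_shift (- s ^+ 2 *: a) t) *
      (expR (- dotp (- s ^+ 2 *: a) (row_of_tuple t) / s ^+ 2 -
        dotp (- s ^+ 2 *: a) (- s ^+ 2 *: a) / (2 * s ^+ 2)))%:E))%E; last first.
  by rewrite -h mule1.
rewrite -ge0_integralZl//.
- apply: eq_integral => t _; rewrite /= mul1e -EFinM -expRD; congr (expR _)%:E.
  by rewrite !(dotpZl, dotpZr); field; rewrite gt_eqF.
- apply: emeasurable_funM; first exact: measurable_cst.
  apply/measurable_EFinP/measurableT_comp => //; apply: measurable_funB => //.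
  apply: measurable_funM => //; apply: measurable_funN.
  exact: measurable_dotp_row_of_tuple.
- by move=> t _; rewrite /= mul1e lee_fin expR_ge0.
Qed.

Lemma gaussian_integrable_expR a :
  N.-integrable setT (EFin \o (fun t => expR (dotp a (row_of_tuple t)))).
Proof.
apply/integrableP; split.
  apply/measurable_EFinP/measurableT_comp => //.
  exact: measurable_dotp_row_of_tuple.
under eq_integral do rewrite /= ger0_norm ?expR_ge0//.
by rewrite gaussian_mgf ltry.
Qed.

Lemma Rintegral_gaussian_mgf a :
  \int[N]_t expR (dotp a (row_of_tuple t)) = expR (s ^+ 2 * dotp a a / 2).
Proof. by rewrite /Rintegral gaussian_mgf. Qed.

Lemma gaussian_integrable_sqr a :
  N.-integrable setT (EFin \o (fun t => dotp a (row_of_tuple t) ^+ 2)).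
Proof.
apply: (@le_integrable _ _ _ _ _ _ _ (EFin \o (fun t =>
  expR (dotp a (row_of_tuple t)) + expR (dotp (- a) (row_of_tuple t))))) => //.
- apply/measurable_EFinP/measurable_funX.
  exact: measurable_dotp_row_of_tuple.
- move=> t _ /=; rewrite lee_fin !ger0_norm ?sqr_ge0 ?addr_ge0 ?expR_ge0// dotpNl.
  by apply: le_trans (sqr_le_expRD _); rewrite lerDl.
- apply: (@eq_integrable _ _ _ _ _ _ ((EFin \o (fun t => expR (dotp a (row_of_tuple t)))) \+
    (EFin \o (fun t => expR (dotp (- a) (row_of_tuple t)))))) => //.
  by apply: integrableD => //; exact: gaussian_integrable_expR.
Qed.

Lemma gaussian_integrable_dotp a :
  N.-integrable setT (EFin \o (fun t => dotp a (row_of_tuple t))).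
Proof.
apply: (@le_integrable _ _ _ _ _ _ _ (EFin \o (fun t =>
  expR (dotp a (row_of_tuple t)) + expR (dotp (- a) (row_of_tuple t))))) => //.
- by apply/measurable_EFinP; exact: measurable_dotp_row_of_tuple.
- move=> t _ /=; rewrite lee_fin [leRHS]ger0_norm ?addr_ge0 ?expR_ge0// dotpNl.
  apply: le_trans (sqr_le_expRD _); set z := dotp _ _.
  rewrite -(real_normK (num_real z)); have := sqr_ge0 (`|z| - 2^-1).
  by move: `|z| => x; rewrite !expr2; lra.
- apply: (@eq_integrable _ _ _ _ _ _ ((EFin \o (fun t => expR (dotp a (row_of_tuple t)))) \+
    (EFin \o (fun t => expR (dotp (- a) (row_of_tuple t)))))) => //.
  by apply: integrableD => //; exact: gaussian_integrable_expR.
Qed.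

Let gaussian_c a : 0 <= s ^+ 2 * dotp a a / 2.
Proof. by rewrite divr_ge0// mulr_ge0 ?sqr_ge0// dotp_ge0. Qed.

(** Integrating [1 + e z <= expR (e z)] bounds [e] times the mean by a quantity of order [e^2], so
    the mean is at most [0]; the same for [- a] gives equality. *)
Lemma gaussian_mean a : \int[N]_t dotp a (row_of_tuple t) = 0.
Proof.
have le0 (b : 'rV[R]_d) : \int[N]_t dotp b (row_of_tuple t) <= 0.
  apply: (expR_second_order_le (gaussian_c b)) => e e0.
  rewrite lerBrDl (_ : e ^+ 2 * _ = s ^+ 2 * dotp (e *: b) (e *: b) / 2); last first.
    by rewrite dotpZl dotpZr; ring.
  have ib := gaussian_integrable_dotp b.
  have i1 := bounded_mfun_integrable N (bounded_mfun_cst (1 : R)).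
  have ieb : N.-integrable setT (EFin \o (fun t => e * dotp b (row_of_tuple t))).
    have := integrableZl measurableT e ib.
    by apply: eq_integrable => // t _ /=; rewrite EFinM.
  rewrite -Rintegral_gaussian_mgf -RintegralZl// -[X in X + _](Rintegral_prob_cst N).
  rewrite -RintegralD//; apply: le_Rintegral => //.
  - by have := integrableD measurableT i1 ieb; apply: eq_integrable.
  - exact: gaussian_integrable_expR.
  - by move=> t _; rewrite dotpZl expR_ge1Dx.
apply/eqP; rewrite eq_le le0/= -oppr_le0.
have := le0 (- a); rewrite (@eq_Rintegral _ _ _ _ _ (fun t => -1 * dotp a (row_of_tuple t))).
  by rewrite RintegralZl ?mulN1r//; exact: gaussian_integrable_dotp.
by move=> t _; rewrite dotpNl mulN1r.
Qed.

(** [sqr_le_expRD] at [sqrt e * z], integrated, gives a bound of first order in [e]; the two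
    exponentials have the same mean, whence the factor [1 / 2]. *)
Lemma gaussian_second_moment_le a :
  \int[N]_t dotp a (row_of_tuple t) ^+ 2 <= s ^+ 2 * dotp a a.
Proof.
have c0 := gaussian_c a.
suff : 2^-1 * \int[N]_t dotp a (row_of_tuple t) ^+ 2 <= s ^+ 2 * dotp a a / 2.
  by rewrite mulrC ler_pM2r// invr_gt0.
apply: (expR_first_order_le c0) => e e0.
have iz := gaussian_integrable_sqr a.
have i1 := bounded_mfun_integrable N (bounded_mfun_cst (1 : R)).
pose k := Num.sqrt e; have k2 : k ^+ 2 = e by rewrite sqr_sqrtr// ltW.
have iez : N.-integrable setT (EFin \o (fun t => e * dotp a (row_of_tuple t) ^+ 2)).
  have := integrableZl measurableT e iz.
  by apply: eq_integrable => // t _ /=; rewrite EFinM.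
have i2 := gaussian_integrable_expR (k *: a).
have i3 := gaussian_integrable_expR (- (k *: a)).
have expE : e * (s ^+ 2 * dotp a a / 2) = s ^+ 2 * dotp (k *: a) (k *: a) / 2.
  by rewrite dotpZl dotpZr -k2; ring.
rewrite lerBrDl expE.
have -> : expR (s ^+ 2 * dotp (k *: a) (k *: a) / 2) =
    2^-1 * \int[N]_t (expR (dotp (k *: a) (row_of_tuple t)) +
      expR (dotp (- (k *: a)) (row_of_tuple t))).
  rewrite RintegralD// !Rintegral_gaussian_mgf dotpNl dotpNr opprK.
  by move: (expR _) => x; field.
rewrite mulrCA -RintegralZl//.
rewrite (_ : 1 + _ = 2^-1 * \int[N]_t (2 : R) +
    2^-1 * \int[N]_t (e * dotp a (row_of_tuple t) ^+ 2)); last first.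
  by rewrite Rintegral_prob_cst mulVf.
rewrite -mulrDr -RintegralD//; last exact: bounded_mfun_integrable (bounded_mfun_cst 2).
rewrite ler_pM2l ?invr_gt0//; apply: le_Rintegral => //.
- have := integrableD measurableT (bounded_mfun_integrable N (bounded_mfun_cst (2 : R))) iez.
  exact: eq_integrable.
- by have := integrableD measurableT i2 i3; apply: eq_integrable.
move=> t _; rewrite dotpNl dotpZl; apply: le_trans (sqr_le_expRD _).
by rewrite exprMn k2 addrC.
Qed.

(** Integrating [2 b |z| <= b^2 + z^2] and taking [b = s * enorm a] plays the role of Cauchy-Schwarz
    for integrals. *)
Lemma gaussian_abs_moment_le a :
  \int[N]_t `|dotp a (row_of_tuple t)| <= s * enorm a.
Proof.
have iz := gaussian_integrable_sqr a.
have ia := integrable_norm (gaussian_integrable_dotp a).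
have young (b : R) : 0 < b ->
    2 * b * \int[N]_t `|dotp a (row_of_tuple t)| <= b ^+ 2 + (s * enorm a) ^+ 2.
  move=> b0; rewrite exprMn enorm_sqr.
  apply: le_trans (lerD (lexx _) (gaussian_second_moment_le a)).
  rewrite -[X in X + _](Rintegral_prob_cst N) -RintegralZl//.
  have ib := bounded_mfun_integrable N (bounded_mfun_cst (b ^+ 2)).
  rewrite -RintegralD//; apply: le_Rintegral => //.
  - have := integrableZl measurableT (2 * b) ia.
    by apply: eq_integrable => // t _ /=; rewrite EFinM.
  - by have := integrableD measurableT ib iz; apply: eq_integrable.
  move=> t _; rewrite -[X in _ + X]real_normK ?num_real// -subr_ge0.
  rewrite (_ : _ - _ = (b - `|dotp a (row_of_tuple t)|) ^+ 2) ?sqr_ge0//; ring.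
(* The optimal [b] is [0] here; if the moment were positive, taking [b] equal to it would give
   [2 b^2 <= b^2]. *)
have [v0|v0] := eqVneq (s * enorm a) 0.
  rewrite v0; apply: contrapT => /negP; rewrite -ltNge => m0.
  have := young _ m0; rewrite v0 expr0n addr0 -mulrA -expr2.
  by have := exprn_gt0 2 m0; lra.
have v_gt0 : 0 < s * enorm a.
  by rewrite lt_neqAle eq_sym v0 mulr_ge0 ?enorm_ge0// ltW.
have := young _ v_gt0; rewrite (_ : _ ^+ 2 + _ = 2 * (s * enorm a) * (s * enorm a)).
  by rewrite ler_pM2l// mulr_gt0.
by ring.
Qed.

End gaussian_moments.

(** * Uniform deviations of a Lipschitz class *)

(** The index set is nonempty, and starting the fold at [F ord0], one of the values, avoids an
    artificial lower bound on the maximum. *)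
Definition bmax (R : realType) k (F : 'I_k.+1 -> R) : R :=
  \big[Num.max/F ord0]_(i < k.+1) F i.

Section bmax.
Context {R : realType} {k : nat}.
Implicit Types F G : 'I_k.+1 -> R.

Lemma le_bmax F i : F i <= bmax F.
Proof. exact: le_bigmax. Qed.

Lemma bmax_le F (c : R) : (forall i, F i <= c) -> bmax F <= c.
Proof. by move=> Fc; apply: bigmax_le => // i _; exact: Fc. Qed.

Lemma bmaxD_le F G (c : R) : (forall i j, F i + G j <= c) -> bmax F + bmax G <= c.
Proof.
move=> FGc; rewrite -lerBrDr; apply: bmax_le => i.
by rewrite lerBrDr -lerBrDl; apply: bmax_le => j; rewrite lerBrDl.
Qed.

Lemma bounded_mfun_bmax disp (T : measurableType disp) (F : 'I_k.+1 -> T -> R) :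
  (forall i, bounded_mfun (F i)) -> bounded_mfun (fun x => bmax (F ^~ x)).
Proof. by move=> bF; exact: bounded_mfun_bigmax. Qed.

End bmax.

(** Midpoint concavity of the square root, used to merge the two signs produced by
    [contraction_step]. *)
Lemma sqrtr_midpoint_le (R : realType) (a b : R) : 0 <= a -> 0 <= b ->
  Num.sqrt a + Num.sqrt b <= 2 * Num.sqrt ((a + b) / 2).
Proof.
move=> a0 b0; have ab0 : 0 <= (a + b) / 2 by rewrite divr_ge0// addr_ge0.
rewrite -(ler_pXn2r (ltn0Sn 1)) ?nnegrE ?addr_ge0 ?mulr_ge0 ?sqrtr_ge0//.
rewrite exprMn (sqr_sqrtr ab0) sqrrD (sqr_sqrtr a0) (sqr_sqrtr b0).
have := sqr_ge0 (Num.sqrt a - Num.sqrt b).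
rewrite sqrrB (sqr_sqrtr a0) (sqr_sqrtr b0).
by move: (_ *+ 2) => z; lra.
Qed.

Section finite_class.
Context {disp : measure_display} {T : measurableType disp} {R : realType} {d : nat}.
Context (D : probability T R) (x : T -> 'rV[R]_d) (M kappa r : R).
Hypothesis mx : forall w, measurable_fun setT (fun p => dotp w (x p)).
Hypothesis xM : forall p, enorm (x p) <= M.
Context {k : nat} (w : 'I_k.+1 -> 'rV[R]_d) (h : 'I_k.+1 -> T -> R).
Hypothesis wr : forall i, enorm (w i) <= r.
Hypothesis bh : forall i, bounded_mfun (h i).
Hypothesis lip_h : forall i j p,
  `|h i p - h j p| <= kappa * `|dotp (w i) (x p) - dotp (w j) (x p)|.

Lemma bounded_mfun_dotp (v : 'rV[R]_d) : bounded_mfun (fun p => dotp v (x p)).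
Proof.
split => //; exists (enorm v * M) => p; apply: le_trans (normr_dotp_le _ _) _.
by apply: ler_wpM2l => //; exact: enorm_ge0.
Qed.

Let m i := \int[D]_p h i p.

(* Symmetrization and contraction for a single observation, without Rademacher variables: the
   max is convex, so [c i + (h i p - m i)], the midpoint of [c i + 2 * h i p] and
   [c i - 2 * m i], only involves the mean of [c i - 2 * h i p]. *)
Lemma contraction_step (c : 'I_k.+1 -> R) :
  \int[D]_p bmax (fun i => c i + (h i p - m i)) <=
  \int[D]_p (2^-1 * (bmax (fun i => c i + 2 * kappa * dotp (w i) (x p)) +
                     bmax (fun i => c i - 2 * kappa * dotp (w i) (x p)))).
Proof.
have bc i := bounded_mfun_cst (T := T) (c i).
have b2h i : bounded_mfun (fun p => 2 * h i p).
  by apply: bounded_mfunM => //; exact: bounded_mfun_cst.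
have bkx i : bounded_mfun (fun p => 2 * kappa * dotp (w i) (x p)).
  by apply: bounded_mfunM (bounded_mfun_dotp _); exact: bounded_mfun_cst.
have bP : bounded_mfun (fun p => bmax (fun i => c i + 2 * h i p)).
  by apply: bounded_mfun_bmax => i; exact: bounded_mfunD.
have bN : bounded_mfun (fun p => bmax (fun i => c i - 2 * h i p)).
  by apply: bounded_mfun_bmax => i; exact: bounded_mfunB.
pose q := \int[D]_p bmax (fun i => c i - 2 * h i p).
have mq i : c i - 2 * m i <= q.
  have -> : c i - 2 * m i = \int[D]_p (c i - 2 * h i p).
    by rewrite RintegralB_bounded// Rintegral_prob_cst RintegralZl_bounded.
  apply: le_Rintegral_bounded => //; first exact: bounded_mfunB.
  by move=> p; exact: (le_bmax (fun i => c i - 2 * h i p)).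
apply: (@le_trans _ _ (\int[D]_p (2^-1 * (bmax (fun i => c i + 2 * h i p) + q)))).
  apply: le_Rintegral_bounded.
  - apply: bounded_mfun_bmax => i; apply: bounded_mfunD => //.
    by apply: bounded_mfunB => //; exact: bounded_mfun_cst.
  - apply: bounded_mfunM; first exact: bounded_mfun_cst.
    by apply: bounded_mfunD => //; exact: bounded_mfun_cst.
  move=> p; apply: bmax_le => i; rewrite mulrC ler_pdivlMr//.
  have := le_bmax (fun i => c i + 2 * h i p) i; have := mq i.
  by move: (m i) (h i p) (c i) => a b e; lra.
have bPN : bounded_mfun (fun p => 2^-1 * (bmax (fun i => c i + 2 * h i p) +
    bmax (fun i => c i - 2 * h i p))).
  by apply: bounded_mfunM; [exact: bounded_mfun_cst|exact: bounded_mfunD].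
have -> : \int[D]_p (2^-1 * (bmax (fun i => c i + 2 * h i p) + q)) =
    \int[D]_p (2^-1 * (bmax (fun i => c i + 2 * h i p) +
      bmax (fun i => c i - 2 * h i p))).
  rewrite !RintegralZl_bounded ?RintegralD_bounded ?Rintegral_prob_cst//.
  - exact: bounded_mfun_cst.
  - exact: bounded_mfunD.
  - by apply: bounded_mfunD => //; exact: bounded_mfun_cst.
apply: le_Rintegral_bounded => //.
  apply: bounded_mfunM; first exact: bounded_mfun_cst.
  by apply: bounded_mfunD; apply: bounded_mfun_bmax => i;
    [exact: bounded_mfunD|exact: bounded_mfunB].
move=> p; rewrite ler_pM2l ?invr_gt0//; apply: bmaxD_le => i j.
have hij := le_trans (ler_norm _) (lip_h i j p).
have := le_bmax (fun i => c i + 2 * kappa * dotp (w i) (x p)).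
have := le_bmax (fun i => c i - 2 * kappa * dotp (w i) (x p)).
move: (bmax _) (bmax _) => A B BA AA.
have A1 := AA i; have A2 := AA j; have B1 := BA i; have B2 := BA j.
(* The sign decides which of [i] and [j] is tested in the maximum with [+] and which in the one with
   [-]; this exchange removes the absolute value. *)
move: A1 A2 B1 B2 hij; have [s|s] := ler0P (dotp (w i) (x p) - dotp (w j) (x p)).
  by lra.
by lra.
Qed.

(** The linear term in [u] accumulates the observations already contracted: each step trades one
    deviation for a shift of [u] by [2 kappa x] with either sign. Averaging the squared norms over
    the two signs cancels the cross term and adds at most [(2 kappa M)^2]; once no observation is
    left, Cauchy-Schwarz bounds the linear term. *)
Lemma sup_deviation_mean_le n (u : 'rV[R]_d) :
  \int[power_prob D n]_S
    bmax (fun i => dotp (w i) u + \sum_(j < n) (h i (tnth S j) - m i)) <=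
  r * Num.sqrt (dotp u u + n%:R * (2 * kappa * M) ^+ 2).
Proof.
have r0 : 0 <= r := le_trans (enorm_ge0 _) (wr ord0).
have bsum l i : bounded_mfun (fun S : l.-tuple T => \sum_(j < l) (h i (tnth S j) - m i)).
  apply: bounded_mfun_sum => j; apply: bounded_mfunB; last exact: bounded_mfun_cst.
  exact: (bounded_mfun_comp (measurable_tnth j)).
have bsumu l v i : bounded_mfun (fun S : l.-tuple T =>
    dotp (w i) v + \sum_(j < l) (h i (tnth S j) - m i)).
  by apply: bounded_mfunD => //; exact: bounded_mfun_cst.
have bG l v : bounded_mfun (fun S : l.-tuple T =>
    bmax (fun i => dotp (w i) v + \sum_(j < l) (h i (tnth S j) - m i))).
  exact: bounded_mfun_bmax.
elim: n u => [|n IH] u.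
  rewrite Rintegral_power_prob0 mul0r addr0 -/(enorm u).
  apply: bmax_le => i; rewrite big_ord0 addr0; apply: le_trans (dotp_le_enorm _ _) _.
  by apply: ler_wpM2r => //; exact: enorm_ge0.
rewrite Rintegral_power_probS//.
pose c S i := dotp (w i) u + \sum_(j < n) (h i (tnth S j) - m i).
pose f (z : T * n.-tuple T) := bmax (fun i => c z.2 i + (h i z.1 - m i)).
pose g (z : T * n.-tuple T) :=
  2^-1 * (bmax (fun i => c z.2 i + 2 * kappa * dotp (w i) (x z.1)) +
          bmax (fun i => c z.2 i - 2 * kappa * dotp (w i) (x z.1))).
have bc i : bounded_mfun (fun z : T * n.-tuple T => c z.2 i).
  exact: (bounded_mfun_comp measurable_snd (bsumu n u i)).
have bf : bounded_mfun f.
  apply: bounded_mfun_bmax => i; apply: bounded_mfunD => //.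
  apply: bounded_mfunB; last exact: bounded_mfun_cst.
  exact: (bounded_mfun_comp measurable_fst (bh i)).
have bkx i : bounded_mfun (fun z : T * n.-tuple T => 2 * kappa * dotp (w i) (x z.1)).
  apply: bounded_mfunM; first exact: bounded_mfun_cst.
  exact: (bounded_mfun_comp measurable_fst (bounded_mfun_dotp (w i))).
have bg : bounded_mfun g.
  apply: bounded_mfunM; first exact: bounded_mfun_cst.
  by apply: bounded_mfunD; apply: bounded_mfun_bmax => i;
    [exact: bounded_mfunD|exact: bounded_mfunB].
rewrite (_ : \int[D]_p _ = \int[D]_p \int[power_prob D n]_S f (p, S)); last first.
  apply: eq_Rintegral => p _; apply: eq_Rintegral => S _; congr bmax.
  apply/funext => i; rewrite big_ord_recl tnth0 /c /= -[RHS]addrA; congr (_ + _).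
  by rewrite addrC; congr (_ + _); apply: eq_bigr => j _; rewrite tnthS.
rewrite (bounded_Rfubini _ _ bf).
apply: (@le_trans _ _ (\int[power_prob D n]_S \int[D]_p g (p, S))).
  apply: le_Rintegral_bounded.
  - exact: (bounded_mfun_Rintegral1 D (power_prob D n) bf).
  - exact: (bounded_mfun_Rintegral1 D (power_prob D n) bg).
  by move=> S; exact: (contraction_step (c S)).
rewrite -(bounded_Rfubini _ _ bg); apply: Rintegral_le_cst.
  exact: (bounded_mfun_Rintegral2 D (power_prob D n) bg).
move=> p; set B := n.+1%:R * _.
have cD v : (fun S => bmax (fun i => c S i + 2 * kappa * dotp (w i) v)) =
    (fun S => bmax (fun i => dotp (w i) (u + (2 * kappa) *: v) +
      \sum_(j < n) (h i (tnth S j) - m i))).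
  by apply/funext => S; congr bmax; apply/funext => i; rewrite /c dotpDr dotpZr addrAC.
have cN v : (fun S => bmax (fun i => c S i - 2 * kappa * dotp (w i) v)) =
    (fun S => bmax (fun i => dotp (w i) (u - (2 * kappa) *: v) +
      \sum_(j < n) (h i (tnth S j) - m i))).
  apply/funext => S; congr bmax; apply/funext => i.
  by rewrite /c dotpDr dotpNr dotpZr addrAC.
rewrite /g /= RintegralZl_bounded; last first.
  by apply: bounded_mfunD; rewrite ?cD ?cN.
rewrite RintegralD_bounded ?cD ?cN//.
apply: le_trans (ler_wpM2l _ (lerD (IH _) (IH _))) _; first by rewrite invr_ge0.
rewrite -mulrDr mulrCA; apply: ler_wpM2l => //.
have BM : 0 <= n%:R * (2 * kappa * M) ^+ 2 by rewrite mulr_ge0// sqr_ge0.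
rewrite ler_pdivrMl//; apply: le_trans (sqrtr_midpoint_le _ _) _.
- by rewrite addr_ge0// dotp_ge0.
- by rewrite addr_ge0// dotp_ge0.
rewrite ler_pM2l// ler_wsqrtr// !(dotpDl, dotpDr, dotpNl, dotpNr, dotpZl, dotpZr).
have xpM : dotp (x p) (x p) <= M ^+ 2.
  by rewrite -enorm_sqr ler_pXn2r ?nnegrE ?enorm_ge0// (le_trans (enorm_ge0 _) (xM p)).
have : (2 * kappa) ^+ 2 * dotp (x p) (x p) <= (2 * kappa) ^+ 2 * M ^+ 2.
  by apply: ler_wpM2l => //; exact: sqr_ge0.
rewrite /B -[n.+1%:R]natr1 (dotpC (x p) u).
move: (dotp (x p) (x p)) (dotp u u) (dotp u (x p)) => a b e.
by rewrite !exprMn !expr2; lra.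
Qed.

End finite_class.

(** * The Huber loss and its Gaussian smoothing *)

Section huber_loss.
Context {R : realType} (rho : R) (rho0 : 0 < rho).
Implicit Types u v z y : R.

Lemma huberE z y : huber rho z y = huber rho (z - y) 0.
Proof. by rewrite /huber subr0. Qed.

Lemma huber_ge0 z y : 0 <= huber rho z y.
Proof.
rewrite /huber; case: ifPn => [_|]; first by rewrite divr_ge0 ?sqr_ge0// mulr_ge0// ltW.
by rewrite -ltNge subr_ge0; have := rho0; lra.
Qed.

(* The Huber loss is the Moreau envelope of the absolute value; [c] and [u - rho * c] are its
   gradient and its proximal point at [u]. *)
Lemma huber_gradient u : exists2 c, `|c| <= 1 & forall v,
  0 <= huber rho v 0 - huber rho u 0 - c * (v - u) <= (v - u) ^+ 2 / (2 * rho).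
Proof.
have rn0 : rho != 0 by rewrite gt_eqF.
have envelope v b : huber rho v 0 <= (v - b) ^+ 2 / (2 * rho) + `|b|.
  rewrite -subr_ge0 -(pmulr_rge0 _ (_ : 0 < 2 * rho)) ?mulr_gt0// /huber subr0.
  case: ifPn => [|_].
    rewrite ler_norml => /andP[v1 v2].
    rewrite (_ : 2 * rho * _ = b ^+ 2 + 2 * (rho * `|b| - v * b)); last by field.
    rewrite addr_ge0 ?sqr_ge0// mulr_ge0// subr_ge0 (le_trans (ler_norm _))// normrM.
    by apply: ler_wpM2r => //; rewrite ler_norml v1.
  rewrite (_ : 2 * rho * _ = (v - b) ^+ 2 + rho ^+ 2 - 2 * rho * (`|v| - `|b|)); last by field.
  apply: (@le_trans _ _ ((`|v - b| - rho) ^+ 2)); first exact: sqr_ge0.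
  rewrite sqrrB real_normK ?num_real// -subr_ge0.
  rewrite (_ : _ - _ = 2 * rho * (`|v - b| - (`|v| - `|b|))); last by ring.
  apply: mulr_ge0; first by rewrite mulr_ge0// ltW.
  by rewrite subr_ge0 lerB_dist.
have dual v c : `|c| <= 1 -> c * v - rho * c ^+ 2 / 2 <= huber rho v 0.
  move=> c1; rewrite -subr_ge0 -(pmulr_rge0 _ (_ : 0 < 2 * rho)) ?mulr_gt0// /huber subr0.
  case: ifPn => [_|].
    rewrite (_ : 2 * rho * _ = (v - rho * c) ^+ 2); last by field.
    exact: sqr_ge0.
  rewrite -ltNge => vr.
  rewrite (_ : 2 * rho * _ = rho * (rho * (c ^+ 2 - 1) + 2 * (`|v| - c * v))); last by field.
  have cv : c * v <= `|c| * `|v| by rewrite -normrM ler_norm.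
  apply: mulr_ge0; first exact: ltW.
  rewrite -(real_normK (num_real c)).
  move: (normr_ge0 c) c1 cv vr; move: `|c| `|v| (c * v) => a b e a0 a1 eab rb.
  have h1 : (rho * (1 - a)) * (1 + a) <= (b * (1 - a)) * 2.
    apply: ler_pM.
    - by rewrite mulr_ge0 ?subr_ge0// ltW.
    - by rewrite addr_ge0.
    - by rewrite ler_wpM2r ?subr_ge0// ltW.
    - by lra.
  have : 0 <= b * (1 - a) * 2 - rho * (1 - a) * (1 + a) by rewrite subr_ge0.
  by lra.
(* [envelope] bounds the loss above by any candidate in the infimum, [dual] below by any slope in
   [[-1, 1]]. It suffices that one [c] attains both at [u]: [dual] at [v] then gives the lower
   estimate and [envelope] at [v] with [b = u - rho * c] the upper one. *)
suff [c c1 cE] : exists2 c, `|c| <= 1 &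
    huber rho u 0 = c * u - rho * c ^+ 2 / 2 /\
    huber rho u 0 = rho * c ^+ 2 / 2 + `|u - rho * c|.
  exists c => // v; have [E1 E2] := cE; apply/andP; split.
    by have := dual v c c1; rewrite E1; lra.
  rewrite E2; have := envelope v (u - rho * c).
  rewrite (_ : (v - (u - rho * c)) ^+ 2 / (2 * rho) =
    (v - u) ^+ 2 / (2 * rho) + c * (v - u) + rho * c ^+ 2 / 2); last by field.
  by lra.
rewrite /huber subr0; case: ifPn => [ur|].
  exists (u / rho); first by rewrite normrM normfV (gtr0_norm rho0) ler_pdivrMr// mul1r.
  split; first by field.
  by rewrite [rho * (u / rho)]mulrC divfK// subrr normr0 addr0; field.
rewrite -ltNge => ur; have [u0|u0] := ler0P u.
  move: ur; rewrite ler0_norm// => ur.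
  exists (-1); first by rewrite normrN1.
  split; first by field.
  by rewrite ler0_norm; [field|lra].
move: ur; rewrite gtr0_norm// => ur.
exists 1; first by rewrite normr1.
split; first by field.
by rewrite ger0_norm; [field|lra].
Qed.

Lemma huber_lipschitz u v : `|huber rho u 0 - huber rho v 0| <= `|u - v|.
Proof.
have H a b : huber rho a 0 - huber rho b 0 <= `|a - b|.
  have [c c1 /(_ b) /andP[+ _]] := huber_gradient a.
  have : c * (a - b) <= `|a - b|.
    apply: le_trans (ler_norm _) _; rewrite normrM.
    by rewrite ler_piMl.
  by move: (`|a - b|) => t; lra.
rewrite ler_norml H andbT lerNl opprB distrC; exact: H.
Qed.

Lemma huber00 : huber rho 0 0 = 0.
Proof. by rewrite /huber subrr normr0 ltW// expr0n mul0r. Qed.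

Lemma huber_le_norm u : huber rho u 0 <= `|u|.
Proof.
by have := le_trans (ler_norm _) (huber_lipschitz u 0); rewrite huber00 !subr0.
Qed.

(* Applied to the Huber loss and to [u ^+ 2 / (2 * rho)] minus it, which are both convex. *)
Lemma increment_le (f : R -> R) (a b s : R) : a <= b -> 0 <= s ->
  (forall u, exists c, forall v, 0 <= f v - f u - c * (v - u)) ->
  f (a + s) - f a <= f (b + s) - f b.
Proof.
move=> ab s0 fc.
have [bs0|bs0] := eqVneq (b - a + s) 0.
  have -> : s = 0 by lra.
  by rewrite !addr0 !subrr.
have bs : 0 < b - a + s by rewrite lt_neqAle eq_sym bs0 addr_ge0// subr_ge0.
have [c1 cb] := fc b; have [c2 cas] := fc (a + s).
have ba0 : 0 <= b - a by rewrite subr_ge0.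
(* Both [b] and [a + s] are convex combinations of [a] and [b + s], with weights proportional to [s]
   and [b - a]; these weights cancel the slopes [c1] and [c2]. *)
have h1 := ler_wpM2l s0 (cb a); have h2 := ler_wpM2l ba0 (cb (b + s)).
have h3 := ler_wpM2l ba0 (cas a); have h4 := ler_wpM2l s0 (cas (b + s)).
rewrite -subr_ge0 -(pmulr_rge0 _ bs); move: h1 h2 h3 h4; rewrite !mulr0.
by lra.
Qed.

(** For [v <= u] and [s >= 0] the difference of increments is nonnegative by convexity, and at most
    that of [z^2 / (2 rho)] because the latter minus the loss is convex too. Other signs reduce to
    this by exchanging endpoints. *)
Lemma huber_increment u v s :
  `|(huber rho (u + s) 0 - huber rho u 0) - (huber rho (v + s) 0 - huber rho v 0)|
  <= `|s| * `|u - v| / rho.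
Proof.
wlog s0 : u v s / 0 <= s.
  move=> H; have [|s0] := leP 0 s; first exact: H.
  have := H (u + s) (v + s) (- s) (ltW (_ : 0 < - s)).
  rewrite oppr_gt0 => /(_ s0); rewrite normrN !addrK.
  rewrite (_ : u + s - (v + s) = u - v); last by ring.
  set A := huber rho (u + s) 0; set B := huber rho u 0.
  set C := huber rho (v + s) 0; set E := huber rho v 0.
  by rewrite (_ : A - B - (C - E) = - (B - A - (E - C))) ?normrN//; ring.
wlog vu : u v / v <= u.
  move=> H; have [|/ltW uv] := leP v u; first exact: H.
  by rewrite distrC [`|u - v|]distrC; exact: H.
rewrite (ger0_norm s0) (ger0_norm (_ : 0 <= u - v)) ?subr_ge0//.
have h1 := @increment_le (huber rho ^~ 0) v u s vu s0.
have h2 := @increment_le (fun z => z ^+ 2 / (2 * rho) - huber rho z 0) v u s vu s0.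
have {}h1 : huber rho (v + s) 0 - huber rho v 0 <= huber rho (u + s) 0 - huber rho u 0.
  by apply: h1 => z; have [c _ cz] := huber_gradient z; exists c => z'; have /andP[] := cz z'.
have {}h2 : (v + s) ^+ 2 / (2 * rho) - huber rho (v + s) 0 - (v ^+ 2 / (2 * rho) - huber rho v 0)
   <= (u + s) ^+ 2 / (2 * rho) - huber rho (u + s) 0 - (u ^+ 2 / (2 * rho) - huber rho u 0).
  apply: h2 => z; have [c _ cz] := huber_gradient z; exists (z / rho - c) => z'.
  have /andP[_] := cz z'.
  have -> : (z' - z) ^+ 2 / (2 * rho) =
     z' ^+ 2 / (2 * rho) - z ^+ 2 / (2 * rho) - z / rho * (z' - z).
    by field; rewrite gt_eqF.
  by lra.
rewrite ger0_norm ?subr_ge0//.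
have -> : s * (u - v) / rho = (u + s) ^+ 2 / (2 * rho) - u ^+ 2 / (2 * rho) -
    ((v + s) ^+ 2 / (2 * rho) - v ^+ 2 / (2 * rho)) by field; rewrite gt_eqF.
by lra.
Qed.

Lemma measurable_huber disp (T : measurableType disp) (f g : T -> R) :
  measurable_fun setT f -> measurable_fun setT g ->
  measurable_fun setT (fun p => huber rho (f p) (g p)).
Proof.
move=> mf mg; have mfg : measurable_fun setT (fun p => f p - g p) by exact: measurable_funB.
have mn : measurable_fun setT (fun p => `|f p - g p|) by exact: measurableT_comp.
apply: measurable_fun_ifT.
- exact: measurable_fun_ler.
- by apply: measurable_funM => //; exact: measurable_funX.
- exact: measurable_funB.
Qed.

End huber_loss.

Section gaussian_smoothing.
Context {R : realType} (rho s : R) (rho0 : 0 < rho) (s0 : 0 < s) (d : nat).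
Notation N := (power_prob (@normal_prob R 0 s) d).
Implicit Types (v : 'rV[R]_d) (a b : R).

(** Perturbing [w] by a Gaussian moves the residual [dotp w x - y] by [dotp x g]; so [v] stands for
    the input and [a] for the unperturbed residual. *)
Definition smoothed_huber v a : R :=
  \int[N]_t huber rho (a + dotp v (row_of_tuple t)) 0.

Lemma integrable_huber_gaussian v a :
  N.-integrable setT (EFin \o (fun t => huber rho (a + dotp v (row_of_tuple t)) 0)).
Proof.
have i1 := bounded_mfun_integrable N (bounded_mfun_cst `|a|).
have i2 := integrable_norm (gaussian_integrable_dotp s0 v).
apply: (le_integrable _ _ _ (integrableD measurableT i1 i2)) => //.
- apply/measurable_EFinP/measurable_huber => //; apply: measurable_funD => //.
  exact: measurable_dotp_row_of_tuple.
- move=> t _ /=; rewrite lee_fin ger0_norm ?huber_ge0// ger0_norm ?addr_ge0//.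
  by apply: le_trans (huber_le_norm rho0 _) _; exact: ler_normD.
Qed.

(** Integrate the two inequalities of [huber_gradient] at [a]: the linear term has mean zero and the
    quadratic one is a second moment. *)
Lemma smoothed_huber_bounds v a :
  0 <= smoothed_huber v a - huber rho a 0 <= s ^+ 2 * dotp v v / (2 * rho).
Proof.
have ih := integrable_huber_gaussian v a.
have iz := gaussian_integrable_dotp s0 v.
have iz2 := gaussian_integrable_sqr s0 v.
have i1 := bounded_mfun_integrable N (bounded_mfun_cst (huber rho a 0)).
have [c c1 cP] := huber_gradient rho0 a.
have icz : N.-integrable setT (EFin \o (fun t => c * dotp v (row_of_tuple t))).
  by have := integrableZl measurableT c iz; apply: eq_integrable => // t _ /=; rewrite EFinM.
have iq : N.-integrable setT (EFin \o (fun t => (2 * rho)^-1 * dotp v (row_of_tuple t) ^+ 2)).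
  have := integrableZl measurableT (2 * rho)^-1 iz2.
  by apply: eq_integrable => // t _ /=; rewrite EFinM.
have ilin : N.-integrable setT
    (EFin \o (fun t => huber rho a 0 + c * dotp v (row_of_tuple t))).
  by have := integrableD measurableT i1 icz; apply: eq_integrable.
have linE : \int[N]_t (huber rho a 0 + c * dotp v (row_of_tuple t)) = huber rho a 0.
  by rewrite RintegralD// Rintegral_prob_cst RintegralZl// gaussian_mean// mulr0 addr0.
apply/andP; split.
  rewrite subr_ge0 -{1}linE; apply: le_Rintegral => // t _.
  have /andP[+ _] := cP (a + dotp v (row_of_tuple t)).
  by rewrite [a + _ - a]addrC addKr; lra.
rewrite lerBlDl -{1}linE [s ^+ 2 * _ / _]mulrC.
apply: (@le_trans _ _ (\int[N]_t (huber rho a 0 + c * dotp v (row_of_tuple t) +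
    (2 * rho)^-1 * dotp v (row_of_tuple t) ^+ 2))); last first.
  rewrite RintegralD// linE RintegralZl// lerD2l ler_wpM2l//.
    by rewrite invr_ge0 mulr_ge0// ltW.
  exact: gaussian_second_moment_le.
apply: le_Rintegral => //.
  by have := integrableD measurableT ilin iq; apply: eq_integrable.
move=> t _; have /andP[_] := cP (a + dotp v (row_of_tuple t)).
by rewrite [a + _ - a]addrC addKr [X in _ <= X -> _]mulrC; lra.
Qed.

(** [huber_increment] with the Gaussian perturbation as increment, integrated with the first
    absolute moment. *)
Lemma smoothed_huber_lipschitz v a b :
  `|(smoothed_huber v a - huber rho a 0) - (smoothed_huber v b - huber rho b 0)|
  <= s * enorm v / rho * `|a - b|.
Proof.
have iha := integrable_huber_gaussian v a.
have ihb := integrable_huber_gaussian v b.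
have ia := bounded_mfun_integrable N (bounded_mfun_cst (huber rho a 0)).
have ib := bounded_mfun_integrable N (bounded_mfun_cst (huber rho b 0)).
have iz := integrable_norm (gaussian_integrable_dotp s0 v).
have iA : N.-integrable setT (EFin \o
    (fun t => huber rho (a + dotp v (row_of_tuple t)) 0 - huber rho a 0)).
  by have := integrableB measurableT iha ia; apply: eq_integrable.
have iB : N.-integrable setT (EFin \o
    (fun t => huber rho (b + dotp v (row_of_tuple t)) 0 - huber rho b 0)).
  by have := integrableB measurableT ihb ib; apply: eq_integrable.
have iAB : N.-integrable setT (EFin \o (fun t =>
    (huber rho (a + dotp v (row_of_tuple t)) 0 - huber rho a 0) -
    (huber rho (b + dotp v (row_of_tuple t)) 0 - huber rho b 0))).
  by have := integrableB measurableT iA iB; apply: eq_integrable.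
rewrite /smoothed_huber -(Rintegral_prob_cst N (huber rho a 0)).
rewrite -(Rintegral_prob_cst N (huber rho b 0)) -!RintegralB//.
apply: le_trans (le_normr_Rintegral measurableT iAB) _.
apply: (@le_trans _ _ (\int[N]_t (`|a - b| / rho * `|dotp v (row_of_tuple t)|))).
  apply: le_Rintegral => //.
  - exact: integrable_norm.
  - have := integrableZl measurableT (`|a - b| / rho) iz.
    by apply: eq_integrable => // t _ /=; rewrite EFinM.
  - move=> t _; apply: le_trans (huber_increment rho0 _ _ _) _.
    by rewrite mulrAC mulrC mulrA [_ / _ * _]mulrC mulrA [_ * `|_ - _|]mulrC mulrAC.
rewrite RintegralZl// (_ : _ / _ * `|a - b| = `|a - b| / rho * (s * enorm v)); last by ring.
apply: ler_wpM2l; first by rewrite divr_ge0// ltW.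
exact: gaussian_abs_moment_le.
Qed.

End gaussian_smoothing.

(** * The PAC-Bayes bound *)

Section empirical_mean.
Context {disp : measure_display} {T : measurableType disp} {R : realType}.
Context (D : probability T R) (n : nat) (n0 : (0 < n)%N).
Implicit Type f : T -> R.

Definition empirical_mean f (S : n.-tuple T) : R := n%:R^-1 * \sum_(i < n) f (tnth S i).

Lemma bounded_mfun_tuple_sum k f : bounded_mfun f ->
  bounded_mfun (fun S : k.-tuple T => \sum_(i < k) f (tnth S i)).
Proof.
move=> bf; apply: bounded_mfun_sum => i.
exact: (bounded_mfun_comp (measurable_tnth i)).
Qed.

Lemma bounded_mfun_empirical_mean f : bounded_mfun f -> bounded_mfun (empirical_mean f).
Proof.
move=> bf; apply: bounded_mfunM; first exact: bounded_mfun_cst.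
exact: bounded_mfun_tuple_sum.
Qed.

Lemma Rintegral_tuple_sum k f : bounded_mfun f ->
  \int[power_prob D k]_S (\sum_(i < k) f (tnth S i)) = k%:R * \int[D]_p f p.
Proof.
move=> bf; elim: k => [|k IH].
  by rewrite Rintegral_power_prob0 big_ord0 mul0r.
rewrite Rintegral_power_probS; last exact: bounded_mfun_tuple_sum.
rewrite (@eq_Rintegral _ _ _ _ _ (fun p => f p + k%:R * \int[D]_p f p)); last first.
  move=> p _; rewrite -IH -[X in X + _](Rintegral_prob_cst (power_prob D k)).
  rewrite -RintegralD_bounded; first last.
  - exact: bounded_mfun_tuple_sum.
  - exact: bounded_mfun_cst.
  apply: eq_Rintegral => S _; rewrite big_ord_recl tnth0; congr (_ + _).
  by apply: eq_bigr => i _; rewrite tnthS.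
rewrite RintegralD_bounded//; last exact: bounded_mfun_cst.
by rewrite Rintegral_prob_cst -natr1; ring.
Qed.

Lemma Rintegral_empirical_mean f : bounded_mfun f ->
  \int[power_prob D n]_S empirical_mean f S = \int[D]_p f p.
Proof.
move=> bf; rewrite RintegralZl_bounded; last exact: bounded_mfun_tuple_sum.
by rewrite Rintegral_tuple_sum// mulrA mulVf ?mul1r// pnatr_eq0 -lt0n.
Qed.

Let bounded_differences_empirical_mean f c : (forall p q, f p - f q <= c) ->
  bounded_differences (fun S => - empirical_mean f S) (c / n%:R).
Proof.
move=> fc i S S' SS'; rewrite opprK addrC /empirical_mean -mulrBr mulrC.
rewrite ler_pdivrMr ?ltr0n// divfK ?pnatr_eq0 -?lt0n//.
rewrite -sumrB (bigD1 i)//= big1 ?addr0 => [|j ji]; last by rewrite SS'// subrr.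
exact: fc.
Qed.

Let Rintegral_opp_empirical_mean f : bounded_mfun f ->
  \int[power_prob D n]_S (- empirical_mean f S) = - \int[D]_p f p.
Proof.
move=> bf; rewrite -(Rintegral_empirical_mean bf).
rewrite (@eq_Rintegral _ _ _ _ _ (fun S => -1 * empirical_mean f S)); last first.
  by move=> S _; rewrite mulN1r.
by rewrite RintegralZl_bounded ?mulN1r//; exact: bounded_mfun_empirical_mean.
Qed.

(** One observation changes the empirical mean by at most [c / n], so [mcdiarmid_mgf] gives
    [n (l c / n)^2 / 8 = (l c)^2 / (8 n)]. *)
Lemma deviation_mgf f c l : bounded_mfun f -> (forall p q, f p - f q <= c) -> 0 <= l ->
  \int[power_prob D n]_S expR (l * (\int[D]_p f p - empirical_mean f S)) <=
  expR ((l * c) ^+ 2 / (8 * n%:R)).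
Proof.
move=> bf fc l0; have nn0 : (n%:R : R) != 0 by rewrite pnatr_eq0 -lt0n.
have bN : bounded_mfun (fun S => - empirical_mean f S).
  exact/bounded_mfunN/bounded_mfun_empirical_mean.
have be : bounded_mfun (fun S => expR (l * - empirical_mean f S)).
  by apply/bounded_mfun_expR/bounded_mfunM => //; exact: bounded_mfun_cst.
rewrite (@eq_Rintegral _ _ _ _ _
  (fun S => expR (l * \int[D]_p f p) * expR (l * - empirical_mean f S))); last first.
  by move=> S _; rewrite -expRD -mulrDr.
rewrite RintegralZl_bounded//.
apply: le_trans (ler_wpM2l (expR_ge0 _)
  (mcdiarmid_mgf D bN (bounded_differences_empirical_mean fc) l0)) _.
rewrite Rintegral_opp_empirical_mean// -expRD ler_expR le_eqVlt; apply/orP; left; apply/eqP.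
by field.
Qed.

Lemma hoeffding f c dl : 0 < c -> 0 < dl <= 1 -> bounded_mfun f ->
  (forall p q, f p - f q <= c) ->
  (power_prob D n [set S | (c * Num.sqrt (ln dl^-1 / (2 * n%:R)) <
     \int[D]_p f p - empirical_mean f S)%R] <= dl%:E)%E.
Proof.
move=> c0 dl01 bf fc; have n0' : 0 < n%:R :> R by rewrite ltr0n.
have bN : bounded_mfun (fun S => - empirical_mean f S).
  exact/bounded_mfunN/bounded_mfun_empirical_mean.
have cn0 : 0 < c / n%:R by rewrite divr_gt0.
have := mcdiarmid D n0 cn0 dl01 bN (bounded_differences_empirical_mean fc).
rewrite Rintegral_opp_empirical_mean//.
rewrite (_ : c / n%:R * Num.sqrt _ = c * Num.sqrt (ln dl^-1 / (2 * n%:R))); last first.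
  rewrite -mulrA; congr (_ * _).
  have -> : n%:R * ln dl^-1 / 2 = n%:R ^+ 2 * (ln dl^-1 / (2 * n%:R)).
    by field; rewrite gt_eqF.
  by rewrite sqrtrM ?sqr_ge0// sqrtr_sqr ger0_norm ?ltW// mulKf// gt_eqF.
move=> h; apply: le_trans h; rewrite le_eqVlt; apply/orP; left; apply/eqP; congr (_ _).
apply/seteqP; split => S /=; set I := \int[D]_p f p; set E := empirical_mean f S.
  by lra.
by lra.
Qed.

End empirical_mean.

Section markov.
Context {disp : measure_display} {T : measurableType disp} {R : realType}.

(** [Z] is extended-valued because the Gaussian integral to which it is applied may be infinite for
    some samples. *)
Lemma markov_ge0 (P : probability T R) (Z : T -> \bar R) (K dl : R) :
  measurable_fun setT Z -> (forall S, 0 <= Z S)%E -> 0 < K -> 0 < dl ->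
  (\int[P]_S Z S <= K%:E)%E -> (P [set S | (K / dl)%:E < Z S] <= dl%:E)%E.
Proof.
move=> mZ Z0 K0 dl0 ZK.
set A := [set S | _].
have mA : measurable A.
  by rewrite /A -[X in measurable X]setTI; exact: emeasurable_fun_o_infty.
have : ((K / dl)%:E * P A <= K%:E)%E.
  apply: le_trans ZK; rewrite -integral_cst// integral_mkcond.
  apply: ge0_le_integral => //.
  - by move=> S _; rewrite patchE; case: ifPn => // _; rewrite lee_fin divr_ge0// ltW.
  - by apply/(measurable_restrictT _ _).1.
  - by move=> S _; rewrite patchE; case: ifPn => // /[!inE] /ltW.
rewrite -(@fineK _ (P A)) ?fin_num_measure// -EFinM !lee_fin mulrAC ler_pdivrMr//.
by rewrite ler_pM2l.
Qed.

End markov.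

Section gaussian_change_of_measure.
Context {R : realType} (s : R) (s0 : 0 < s) (d : nat).
Notation N := (power_prob (@normal_prob R 0 s) d).

(* Donsker-Varadhan for a shift of the Gaussian, whose relative entropy is
   [dotp w w / (2 * s ^+ 2)]. *)
Lemma gaussian_donsker_varadhan (w : 'rV[R]_d) (F : d.-tuple (measurableTypeR R) -> R)
    (K : R) : measurable_fun setT F -> 0 < K ->
  N.-integrable setT (EFin \o (fun t => F (tuple_shift w t))) ->
  (\int[N]_t (expR (F t))%:E <= K%:E)%E ->
  \int[N]_t F (tuple_shift w t) <= dotp w w / (2 * s ^+ 2) + ln K.
Proof.
move=> mF K0 iF; rewrite (gaussian_shift w s0); last 2 first.
- by apply/measurable_EFinP; exact: measurableT_comp.
- by move=> t; rewrite lee_fin expR_ge0.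
have iz := gaussian_integrable_dotp s0 w.
(* The shifted [F] plus the logarithm of the Cameron-Martin weight; that logarithm has mean minus
   the relative entropy. *)
pose X t := F (tuple_shift w t) - ((s ^+ 2)^-1 * dotp w (row_of_tuple t)
  + dotp w w / (2 * s ^+ 2)).
have ik := bounded_mfun_integrable N (bounded_mfun_cst (dotp w w / (2 * s ^+ 2))).
have isz : N.-integrable setT (EFin \o (fun t => (s ^+ 2)^-1 * dotp w (row_of_tuple t))).
  have := integrableZl measurableT (s ^+ 2)^-1 iz.
  by apply: eq_integrable => // t _ /=; rewrite EFinM.
have iszk : N.-integrable setT (EFin \o (fun t => (s ^+ 2)^-1 * dotp w (row_of_tuple t)
  + dotp w w / (2 * s ^+ 2))).
  by have := integrableD measurableT isz ik; apply: eq_integrable.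
have iX : N.-integrable setT (EFin \o X).
  by have := integrableB measurableT iF iszk; apply: eq_integrable.
pose a := \int[N]_t X t.
have aE : a = \int[N]_t F (tuple_shift w t) - dotp w w / (2 * s ^+ 2).
  rewrite /a /X RintegralB// RintegralD// Rintegral_prob_cst RintegralZl//.
  by rewrite gaussian_mean// mulr0 add0r.
have -> : (\int[N]_t ((expR (F (tuple_shift w t)))%:E *
   (expR (- dotp w (row_of_tuple t) / s ^+ 2 - dotp w w / (2 * s ^+ 2)))%:E) =
   \int[N]_t (expR (X t))%:E)%E.
  apply: eq_integral => t _; rewrite -EFinM -expRD; congr (expR _)%:E.
  by rewrite /X mulNr [_ / s ^+ 2]mulrC opprD.
move=> XK; rewrite -lerBlDl -aE -ler_expR lnK ?posrE// -lee_fin.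
apply: le_trans XK.
have ia := bounded_mfun_integrable N (bounded_mfun_cst (expR a * (1 - a))).
have iaX : N.-integrable setT (EFin \o (fun t => expR a * X t)).
  by have := integrableZl measurableT (expR a) iX; apply: eq_integrable => // t _ /=; rewrite EFinM.
have iL : N.-integrable setT (EFin \o (fun t => expR a * (1 - a) + expR a * X t)).
  by have := integrableD measurableT ia iaX; apply: eq_integrable.
have -> : expR a = \int[N]_t (expR a * (1 - a) + expR a * X t).
  rewrite RintegralD// Rintegral_prob_cst RintegralZl// -/a -mulrDr subrK.
  by rewrite mulr1.
rewrite EFin_Rintegral//.
have mX : measurable_fun setT (fun t => (expR (X t))%:E).
  apply/measurable_EFinP/measurableT_comp => //.
  by apply/measurable_EFinP; exact: measurable_int iX.
(* Jensen's inequality through the tangent at the mean [a], whose integral is exactly [expR a]. *)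
have tangent t : expR a * (1 - a) + expR a * X t <= expR (X t).
  rewrite -mulrDr.
  have -> : expR (X t) = expR a * expR (X t - a) by rewrite -expRD addrC subrK.
  by rewrite ler_pM2l ?expR_gt0// addrAC -addrA expR_ge1Dx.
have [Xoo|Xfin] := eqVneq (\int[N]_t (expR (X t))%:E)%E +oo%E; first by rewrite Xoo leey.
apply: le_integral => //; last by move=> t _; rewrite lee_fin.
apply/integrableP; split => //.
under eq_integral do rewrite /= ger0_norm ?expR_ge0//.
by rewrite ltey.
Qed.

End gaussian_change_of_measure.

Lemma Rintegral_sum disp (T : measurableType disp) (R : realType)
    (mu : {measure set T -> \bar R}) (I : Type) (r : seq I) (F : I -> T -> R) :
  (forall i, mu.-integrable setT (EFin \o F i)) ->
  \int[mu]_x (\sum_(i <- r) F i x) = \sum_(i <- r) \int[mu]_x F i x.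
Proof.
move=> iF; elim: r => [|i r IH].
  under eq_Rintegral do rewrite big_nil.
  by rewrite Rintegral_cst// mul0r big_nil.
under eq_Rintegral do rewrite big_cons.
rewrite RintegralD// ?IH ?big_cons//.
have h : mu.-integrable setT (fun x => \sum_(i <- r) (F i x)%:E)%E.
  by apply: integrable_sum => // j _; exact: iF.
by apply: eq_integrable h => // x _ /=; rewrite sumEFin.
Qed.

Section huber_regression.
Context {disp : measure_display} {T : measurableType disp} {R : realType} {d n : nat}.
Context (D : probability T R) (x : T -> 'rV[R]_d) (y : T -> R) (M Y rho s : R).
Hypothesis n0 : (0 < n)%N.
Hypothesis mx : forall i, measurable_fun setT (fun p => x p ord0 i).
Hypothesis my : measurable_fun setT y.
Hypothesis xM : forall p, enorm (x p) <= M.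
Hypothesis yY : forall p, `|y p| <= Y.
Hypothesis rho0 : 0 < rho.
Hypothesis s0 : 0 < s.
Notation N := (power_prob (@normal_prob R 0 s) d).
Implicit Types (v w : 'rV[R]_d) (S : n.-tuple T).

Let M0 : 0 <= M := le_trans (enorm_ge0 _) (xM point).

Definition linear_loss v p : R := huber rho (dotp v (x p)) (y p).

Definition risk_gap v S : R := \int[D]_p linear_loss v p - empirical_mean (linear_loss v) S.

Definition smoothed_loss v p : R := smoothed_huber rho s (x p) (dotp v (x p) - y p).

Let measurable_dotp v : measurable_fun setT (fun p => dotp v (x p)).
Proof. by apply: measurable_sum => i; exact: measurable_funM. Qed.

Lemma bounded_mfun_linear_loss v : bounded_mfun (linear_loss v).
Proof.
split; first exact: measurable_huber.
exists (enorm v * M + Y) => p; rewrite ger0_norm ?huber_ge0// /linear_loss huberE.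
apply: le_trans (huber_le_norm rho0 _) _; apply: le_trans (ler_normB _ _) _.
apply: lerD => //; apply: le_trans (normr_dotp_le _ _) _.
by apply: ler_wpM2l => //; exact: enorm_ge0.
Qed.

Lemma measurable_linear_loss_row : measurable_fun setT
  (fun z : d.-tuple (measurableTypeR R) * T => linear_loss (row_of_tuple z.1) z.2).
Proof.
apply: measurable_huber; last exact: measurableT_comp.
apply: measurable_sum => i; apply: measurable_funM.
  under eq_fun do rewrite mxE.
  apply: (@measurableT_comp _ _ _ _ _ _ (fun t : d.-tuple (measurableTypeR R) => tnth t i)) => //.
  exact: measurable_tnth.
exact: (measurableT_comp (mx i)).
Qed.

Let measurable_Rintegral_loss : measurable_fun setT
  (fun t : d.-tuple (measurableTypeR R) => \int[D]_p linear_loss (row_of_tuple t) p).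
Proof.
have mf : measurable_fun setT (fun z : d.-tuple (measurableTypeR R) * T =>
    (linear_loss (row_of_tuple z.1) z.2)%:E).
  by apply/measurable_EFinP; exact: measurable_linear_loss_row.
have := @measurable_fun_fubini_tonelli_F _ _ _ _ _ D _ mf.
move=> /(_ (fun z => _))/(measurableT_comp (fine_measurable measurableT)); apply.
by move=> z; rewrite lee_fin huber_ge0.
Qed.

Lemma measurable_risk_gap_row : measurable_fun setT
  (fun z : d.-tuple (measurableTypeR R) * n.-tuple T => risk_gap (row_of_tuple z.1) z.2).
Proof.
apply: measurable_funB.
  exact: (measurableT_comp measurable_Rintegral_loss).
apply: measurable_funM => //; apply: measurable_sum => i.
have h : measurable_fun setT
    (fun z : d.-tuple (measurableTypeR R) * n.-tuple T => (z.1, tnth z.2 i)).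
  apply: measurable_fun_pair => //.
  exact: (measurableT_comp (measurable_tnth i)).
exact: (measurableT_comp measurable_linear_loss_row h).
Qed.

Lemma linear_loss_shift w t p :
  linear_loss (row_of_tuple (tuple_shift w t)) p =
  huber rho (dotp w (x p) - y p + dotp (x p) (row_of_tuple t)) 0.
Proof.
rewrite /linear_loss huberE row_of_tuple_shift dotpDl (dotpC (row_of_tuple t)).
by rewrite addrAC.
Qed.

Lemma integrable_linear_loss_shift w p :
  N.-integrable setT (EFin \o (fun t => linear_loss (row_of_tuple (tuple_shift w t)) p)).
Proof.
have := integrable_huber_gaussian rho0 s0 (x p) (dotp w (x p) - y p).
by apply: eq_integrable => // t _ /=; rewrite linear_loss_shift.
Qed.

Lemma smoothed_lossE w p :
  smoothed_loss w p = \int[N]_t linear_loss (row_of_tuple (tuple_shift w t)) p.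
Proof. by apply: eq_Rintegral => t _; rewrite linear_loss_shift. Qed.

Lemma smoothed_loss_bounds w p :
  0 <= smoothed_loss w p - linear_loss w p <= s ^+ 2 * M ^+ 2 / (2 * rho).
Proof.
have /andP[h1 h2] := smoothed_huber_bounds rho0 s0 (x p) (dotp w (x p) - y p).
rewrite /linear_loss huberE h1; apply: le_trans h2 _.
rewrite ler_pM2r ?invr_gt0 ?mulr_gt0// ler_wpM2l ?sqr_ge0// -enorm_sqr.
by rewrite ler_pXn2r ?nnegrE ?enorm_ge0.
Qed.

Let measurable_loss_shift w : measurable_fun setT
  (fun z : d.-tuple (measurableTypeR R) * T =>
     (linear_loss (row_of_tuple (tuple_shift w z.1)) z.2)%:E).
Proof.
apply/measurable_EFinP.
have h : measurable_fun setT
    (fun z : d.-tuple (measurableTypeR R) * T => (tuple_shift w z.1, z.2)).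
  apply: measurable_fun_pair => //.
  by apply: measurableT_comp => //; exact: measurable_tuple_shift.
exact: (measurableT_comp measurable_linear_loss_row h).
Qed.

Let loss_shift_ge0 w (z : d.-tuple (measurableTypeR R) * T) :
  (0 <= (linear_loss (row_of_tuple (tuple_shift w z.1)) z.2)%:E)%E.
Proof. by rewrite lee_fin huber_ge0. Qed.

Lemma bounded_mfun_smoothed_loss w : bounded_mfun (smoothed_loss w).
Proof.
split.
  rewrite (_ : smoothed_loss w =
      fun p => \int[N]_t linear_loss (row_of_tuple (tuple_shift w t)) p); last first.
    by apply/funext => p; rewrite smoothed_lossE.
  have := measurable_fun_fubini_tonelli_G _ (measurable_loss_shift w) (@loss_shift_ge0 w)
    (m1 := N).
  by move=> /(measurableT_comp (fine_measurable measurableT)); apply.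
have [_ [K lK]] := bounded_mfun_linear_loss w.
exists (K + s ^+ 2 * M ^+ 2 / (2 * rho)) => p.
have /andP[h1 h2] := smoothed_loss_bounds w p.
have l0 : 0 <= linear_loss w p by exact: huber_ge0.
have := le_trans (ler_norm _) (lK p); rewrite ger0_norm; first by lra.
by lra.
Qed.

(** The shifted loss is unbounded in the Gaussian variable, so the exchange of integrals rests on
    nonnegativity instead of [bounded_Rfubini]. *)
Let tonelli_loss w :
  (\int[N]_t (\int[D]_p linear_loss (row_of_tuple (tuple_shift w t)) p)%:E =
   (\int[D]_p smoothed_loss w p)%:E)%E.
Proof.
under eq_integral.
  move=> t _; rewrite EFin_Rintegral; last first.
    exact/bounded_mfun_integrable/bounded_mfun_linear_loss.
  over.
rewrite (fubini_tonelli _ (measurable_loss_shift w) (@loss_shift_ge0 w)).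
rewrite EFin_Rintegral; last exact/bounded_mfun_integrable/bounded_mfun_smoothed_loss.
apply: eq_integral => p _; rewrite smoothed_lossE EFin_Rintegral//.
exact: integrable_linear_loss_shift.
Qed.

Let integrable_risk_shift w : N.-integrable setT
  (EFin \o (fun t => \int[D]_p linear_loss (row_of_tuple (tuple_shift w t)) p)).
Proof.
apply/integrableP; split.
  apply/measurable_EFinP; apply: (measurableT_comp measurable_Rintegral_loss).
  exact: measurable_tuple_shift.
under eq_integral.
  move=> t _; rewrite /= ger0_norm; last by apply: Rintegral_ge0 => p _; exact: huber_ge0.
  over.
by rewrite tonelli_loss ltry.
Qed.

Let integrable_empirical_shift w S : N.-integrable setT
  (EFin \o (fun t => empirical_mean (linear_loss (row_of_tuple (tuple_shift w t))) S)).
Proof.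
have h : N.-integrable setT (fun t => \sum_(i < n)
    (linear_loss (row_of_tuple (tuple_shift w t)) (tnth S i))%:E)%E.
  by apply: integrable_sum => // i _; exact: integrable_linear_loss_shift.
have := integrableZl measurableT n%:R^-1 h.
by apply: eq_integrable => // t _ /=; rewrite sumEFin EFinM.
Qed.

Lemma integrable_risk_gap_shift w S : N.-integrable setT
  (EFin \o (fun t => risk_gap (row_of_tuple (tuple_shift w t)) S)).
Proof.
have := integrableB measurableT (integrable_risk_shift w) (integrable_empirical_shift w S).
exact: eq_integrable.
Qed.

Lemma Rintegral_risk_gap_shift w S :
  \int[N]_t risk_gap (row_of_tuple (tuple_shift w t)) S =
  \int[D]_p smoothed_loss w p - empirical_mean (smoothed_loss w) S.
Proof.
rewrite /risk_gap (RintegralB _ (integrable_risk_shift w) (integrable_empirical_shift w S))//.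
congr (_ - _); first by rewrite /Rintegral tonelli_loss.
rewrite /empirical_mean RintegralZl//; last first.
  have h : N.-integrable setT (fun t => \sum_(i < n)
      (linear_loss (row_of_tuple (tuple_shift w t)) (tnth S i))%:E)%E.
    by apply: integrable_sum => // i _; exact: integrable_linear_loss_shift.
  by apply: eq_integrable h => // t _ /=; rewrite sumEFin.
congr (_ * _); rewrite Rintegral_sum; last by move=> i; exact: integrable_linear_loss_shift.
by apply: eq_bigr => i _; rewrite smoothed_lossE.
Qed.

Definition risk_gap_mgf (l : R) S : \bar R :=
  (\int[N]_t (expR (l * (risk_gap (row_of_tuple t) S - risk_gap 0 S)))%:E)%E.

Lemma smoothed_risk_gap_le (l K : R) w S : 0 < l -> 0 < K -> (risk_gap_mgf l S <= K%:E)%E ->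
  \int[D]_p smoothed_loss w p - empirical_mean (smoothed_loss w) S - risk_gap 0 S <=
  l^-1 * (dotp w w / (2 * s ^+ 2) + ln K).
Proof.
move=> l0 K0 ZK; pose F t := l * (risk_gap (row_of_tuple t) S - risk_gap 0 S).
have mF : measurable_fun setT F.
  apply: measurable_funM => //; apply: measurable_funB => //.
  exact: (measurableT_comp measurable_risk_gap_row (pair2_measurable S)).
have ig := integrable_risk_gap_shift w S.
have i0 := bounded_mfun_integrable N (bounded_mfun_cst (risk_gap 0 S)).
have igB : N.-integrable setT (EFin \o
    (fun t => risk_gap (row_of_tuple (tuple_shift w t)) S - risk_gap 0 S)).
  by have := integrableB measurableT ig i0; apply: eq_integrable.
have iF : N.-integrable setT (EFin \o (fun t => F (tuple_shift w t))).
  by have := integrableZl measurableT l igB; apply: eq_integrable => // t _ /=; rewrite EFinM.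
have := gaussian_donsker_varadhan s0 mF K0 iF ZK.
rewrite RintegralZl// RintegralB// Rintegral_prob_cst Rintegral_risk_gap_shift.
by move=> h; rewrite mulrC ler_pdivlMr// mulrC.
Qed.

Let gap_difference v S : risk_gap v S - risk_gap 0 S =
  \int[D]_p (linear_loss v p - linear_loss 0 p) -
  empirical_mean (fun p => linear_loss v p - linear_loss 0 p) S.
Proof.
rewrite RintegralB_bounded; try exact: bounded_mfun_linear_loss.
by rewrite /risk_gap /empirical_mean sumrB; ring.
Qed.

(** The loss is 1-Lipschitz in the prediction, so subtracting the loss at [0] leaves a function
    within [enorm v * M] of zero, of oscillation at most [2 * (enorm v * M)]. *)
Let gap_difference_mgf v (l : R) : 0 <= l ->
  (\int[power_prob D n]_S (expR (l * (risk_gap v S - risk_gap 0 S)))%:E <=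
   (expR (l ^+ 2 * M ^+ 2 / (2 * n%:R) * dotp v v))%:E)%E.
Proof.
move=> l0; have nn0 : (n%:R : R) != 0 by rewrite pnatr_eq0 -lt0n.
pose g p := linear_loss v p - linear_loss 0 p.
have bg : bounded_mfun g.
  by apply: bounded_mfunB; exact: bounded_mfun_linear_loss.
have gM p : `|g p| <= enorm v * M.
  rewrite /g /linear_loss huberE (huberE _ (dotp 0 _)).
  apply: le_trans (huber_lipschitz rho0 _ _) _.
  rewrite (dotpC 0) dotp0 sub0r opprK subrK; apply: le_trans (normr_dotp_le _ _) _.
  by apply: ler_wpM2l => //; exact: enorm_ge0.
have gc p q : g p - g q <= 2 * (enorm v * M).
  have := gM p; have := gM q; rewrite !ler_norml => /andP[a1 a2] /andP[b1 b2].
  by move: a1 b2; move: (g p) (g q) (enorm v * M) => a b c; lra.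
have := deviation_mgf D n0 bg gc l0.
rewrite (_ : (l * (2 * (enorm v * M))) ^+ 2 / (8 * n%:R) =
  l ^+ 2 * M ^+ 2 / (2 * n%:R) * dotp v v); last by rewrite -enorm_sqr; field.
rewrite -lee_fin EFin_Rintegral; last first.
  apply/bounded_mfun_integrable/bounded_mfun_expR/bounded_mfunM.
    exact: bounded_mfun_cst.
  by apply: bounded_mfunB; [exact: bounded_mfun_cst|exact: bounded_mfun_empirical_mean].
move=> h; apply: le_trans h; rewrite le_eqVlt; apply/orP; left; apply/eqP.
by apply: eq_integral => S _; rewrite gap_difference.
Qed.

(** For [d > 0], the integral is the [d]-th power of a one-dimensional one and equals [(1 - 1 / (d +
    1))^(- d / 2) = (1 + 1 / d)^(d / 2)], at most [expR (1 / 2)]. Using [d + 1] in the exponent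
    keeps the one-dimensional integral finite when [d = 1]. *)
Lemma gaussian_expR_sqr_le :
  (\int[N]_t (expR ((2 * s ^+ 2 * d.+1%:R)^-1 *
     dotp (row_of_tuple t) (row_of_tuple t)))%:E <= (expR 2^-1)%:E)%E.
Proof.
set b := (2 * _ * _)^-1.
have sn0 : s != 0 by rewrite gt_eqF.
have bE : 2 * b * s ^+ 2 = d.+1%:R^-1.
  by rewrite /b; field; rewrite sn0 addrC natr1 pnatr_eq0.
under eq_integral.
  move=> t _; rewrite /dotp mulr_sumr.
  under eq_bigr do rewrite mxE -expr2.
  over.
(* In dimension [0] the condition [2 * b * s ^+ 2 < 1] fails, but the exponent is an empty sum. *)
have [d0|d0] := posnP d.
  rewrite /=; under eq_integral.
    move=> t _; rewrite big1 => [|i _]; last by have := ltn_ord i; rewrite [X in (_ < X)%N]d0.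
    rewrite expR0; over.
  by rewrite integral_cst//= probability_setT mule1 lee_fin -[leLHS]expR0 ler_expR invr_ge0.
have d0' : (0 : R) < d%:R by rewrite ltr0n.
have b1 : 2 * b * s ^+ 2 < 1 by rewrite bE invf_lt1// ltr1n.
have mb : measurable_fun setT (fun a : measurableTypeR R => b * a ^+ 2).
  by apply: measurable_funM => //; exact: measurable_funX.
rewrite /= (ge0_integral_power_prob_expR_sum d mb (c := (Num.sqrt (1 - 2 * b * s ^+ 2))^-1));
  last exact: normal_prob_expR_sqr.
rewrite lee_fin bE -(ler_pXn2r (ltn0Sn 1)) ?nnegrE ?exprn_ge0 ?invr_ge0 ?sqrtr_ge0 ?expR_ge0//.
rewrite exprAC exprVn sqr_sqrtr; last first.
  by rewrite subr_ge0 invf_le1// ler1n.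
rewrite -expRM_natl divff//.
have -> : (1 - d.+1%:R^-1 : R)^-1 = 1 + d%:R^-1.
  have dS0 : (d%:R + 1 : R) != 0 by rewrite natr1 pnatr_eq0.
  rewrite -[d.+1%:R]natr1 (_ : 1 - _ = d%:R / (d%:R + 1)); last by field.
  by rewrite invf_div; field; rewrite gt_eqF.
apply: (@le_trans _ _ (expR d%:R^-1 ^+ d)).
  by rewrite ler_pXn2r ?nnegrE ?expR_ge0 ?addr_ge0 ?invr_ge0// expR_ge1Dx.
by rewrite -expRM_natl divff// gt_eqF.
Qed.

Let mgf_ge0 l (z : d.-tuple (measurableTypeR R) * n.-tuple T) :
  (0 <= (expR (l * (risk_gap (row_of_tuple z.1) z.2 - risk_gap 0 z.2)))%:E)%E.
Proof. by rewrite lee_fin expR_ge0. Qed.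

Lemma bounded_mfun_risk_gap v : bounded_mfun (risk_gap v).
Proof.
apply: bounded_mfunB; first exact: bounded_mfun_cst.
exact/bounded_mfun_empirical_mean/bounded_mfun_linear_loss.
Qed.

Let measurable_mgf l : measurable_fun setT
  (fun z : d.-tuple (measurableTypeR R) * n.-tuple T =>
    (expR (l * (risk_gap (row_of_tuple z.1) z.2 - risk_gap 0 z.2)))%:E).
Proof.
apply/measurable_EFinP; apply: measurableT_comp => //; apply: measurable_funM => //.
apply: measurable_funB; first exact: measurable_risk_gap_row.
by apply: measurableT_comp => //; have [] := bounded_mfun_risk_gap 0.
Qed.

Lemma measurable_risk_gap_mgf l : measurable_fun setT (risk_gap_mgf l).
Proof.
exact: (measurable_fun_fubini_tonelli_G _ (measurable_mgf l) (@mgf_ge0 l) (m1 := N)).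
Qed.

(* PAC-Bayes; [l] is tuned so that the Gaussian integral of the conditional moment generating
   function stays below [expR (1 / 2)] in every dimension. *)
Lemma risk_gap_mgf_tail l dl : 0 < l -> 0 < dl ->
  l ^+ 2 * M ^+ 2 * s ^+ 2 * d.+1%:R = n%:R ->
  (power_prob D n [set S | ((expR 2^-1 / dl)%:E < risk_gap_mgf l S)%E] <= dl%:E)%E.
Proof.
move=> l0 dl0 lE; apply: markov_ge0 => //.
- exact: measurable_risk_gap_mgf.
- by move=> S; apply: integral_ge0 => t _; rewrite lee_fin expR_ge0.
(* The prior does not depend on the sample, so the expectation over samples can be taken first, for
   each fixed predictor. *)
rewrite /risk_gap_mgf -(fubini_tonelli _ (measurable_mgf l) (@mgf_ge0 l)).
apply: le_trans gaussian_expR_sqr_le; apply: ge0_le_integral => //.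
- by move=> t _; apply: integral_ge0 => S _; rewrite lee_fin expR_ge0.
- exact: (measurable_fun_fubini_tonelli_F _ (measurable_mgf l) (@mgf_ge0 l)).
- apply/measurable_EFinP/measurableT_comp => //; apply: measurable_funM => //.
  apply: measurable_sum => i; under eq_fun do rewrite mxE.
  by apply: measurable_funM; exact: measurable_tnth.
move=> t _.
apply: (@le_trans _ _ (expR (l ^+ 2 * M ^+ 2 / (2 * n%:R) *
    dotp (row_of_tuple t) (row_of_tuple t)))%:E).
  exact: (gap_difference_mgf (row_of_tuple t) (ltW l0)).
rewrite lee_fin ler_expR le_eqVlt; apply/orP; left; apply/eqP; congr (_ * _).
have nn0 : (n%:R : R) != 0 by rewrite pnatr_eq0 -lt0n.
have Mn0 : M != 0.
  by apply: contraNneq nn0 => M_eq0; rewrite -lE M_eq0 expr0n mulr0 !mul0r.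
have dn0 : (d.+1%:R : R) != 0 by rewrite pnatr_eq0.
rewrite -lE; move: (d.+1%:R : R) dn0 => k kn0.
by field; rewrite kn0 Mn0 !gt_eqF.
Qed.
End huber_regression.

(** * The smoothing error *)

Section euclidean_ball.
Context {R : realType} {d : nat}.
Implicit Types u v w : 'rV[R]_d.

Lemma enormD_le u v : enorm (u + v) <= enorm u + enorm v.
Proof.
rewrite -(ler_pXn2r (ltn0Sn 1)) ?nnegrE ?addr_ge0 ?enorm_ge0//.
rewrite enorm_sqr sqrrD !enorm_sqr dotpDl !dotpDr (dotpC v u) -mulr_natl.
by have := dotp_le_enorm u v; lra.
Qed.

Lemma enormZ (c : R) u : enorm (c *: u) = `|c| * enorm u.
Proof.
by rewrite /enorm dotpZl dotpZr mulrA -expr2 sqrtrM ?sqr_ge0// sqrtr_sqr.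
Qed.

Lemma enorm_le_coord u (e : R) : 0 <= e -> (forall i, `|u ord0 i| <= e) ->
  enorm u <= d%:R * e.
Proof.
move=> e0 ue; rewrite -(ler_pXn2r (ltn0Sn 1)) ?nnegrE ?enorm_ge0 ?mulr_ge0//.
rewrite enorm_sqr; apply: (@le_trans _ _ (d%:R * e ^+ 2)).
  rewrite mulr_natl -[X in _ <= _ *+ X]card_ord -sumr_const /dotp.
  apply: ler_sum => i _; rewrite -expr2 -(real_normK (num_real _)).
  by rewrite ler_pXn2r ?nnegrE.
rewrite exprMn ler_wpM2r ?sqr_ge0// -natrX ler_nat.
by case: d => // k; rewrite expnS leq_pmulr// expn_gt0.
Qed.

(** Enumerated rational vectors, pulled back radially into the ball so that every [W i] belongs to
    it even when [r = 0]. The pullback moves [v] by no more than its distance to any point of the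
    ball, so an approximation within [e / 2] becomes one within [e]. *)
Lemma dense_enorm_ball (r : R) : 0 <= r -> exists W : nat -> 'rV[R]_d,
  (forall i, enorm (W i) <= r) /\
  forall w e, enorm w <= r -> 0 < e -> exists i, enorm (W i - w) <= e.
Proof.
move=> r0.
pose proj v : 'rV[R]_d := if enorm v <= r then v else (r / enorm v) *: v.
pose W i := if unpickle i is Some q then proj (map_mx ratr (q : 'rV[rat]_d)) else 0.
have projr v : enorm (proj v) <= r.
  rewrite /proj; case: ifPn => //; rewrite -ltNge => rv.
  have v0 : 0 < enorm v := le_lt_trans r0 rv.
  by rewrite enormZ ger0_norm ?divr_ge0 ?enorm_ge0// divfK// gt_eqF.
have proj_dist v w : enorm w <= r -> enorm (proj v - v) <= enorm (v - w).
  move=> wr; rewrite /proj; case: ifPn => [_|].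
    by rewrite subrr /enorm dotp0 sqrtr0 enorm_ge0.
  rewrite -ltNge => rv; have v0 : 0 < enorm v := le_lt_trans r0 rv.
  rewrite -[X in _ - X]scale1r -scalerBl enormZ distrC ger0_norm; last first.
    by rewrite subr_ge0 ler_pdivrMr// mul1r ltW.
  rewrite mulrBl mul1r divfK ?gt_eqF// lerBlDr.
  apply: (@le_trans _ _ (enorm (v - w) + enorm w)); last by rewrite lerD2l.
  by rewrite -{1}[v](subrK w) enormD_le.
exists W; split.
  move=> i; rewrite /W; case: (unpickle i) => [q|]; first exact: projr.
  by rewrite /enorm dotp0 sqrtr0.
move=> w e wr e0; pose eta := e / (2 * d.+1%:R).
have eta0 : 0 < eta by rewrite divr_gt0.
have /choice[q qP] : forall i : 'I_d, exists q : rat, `|ratr q - w ord0 i| <= eta.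
  move=> i; have /rat_in_itvoo[q p] : w ord0 i - eta < w ord0 i + eta by lra.
  by exists q; apply: ltW; move: p; rewrite in_itv /= ltr_distl.
exists (pickle (\row_i q i)); rewrite /W pickleK.
set v := map_mx _ _.
have vw : enorm (v - w) <= e / 2.
  apply: (@le_trans _ _ (d%:R * eta)).
    apply: enorm_le_coord; first exact: ltW.
    by move=> i; rewrite !mxE; exact: qP.
  have D0 : (0 : R) < d.+1%:R by rewrite ltr0n.
  rewrite (_ : d%:R * eta = e / 2 * (d%:R / d.+1%:R)); last first.
    by rewrite /eta; move: D0; move: (d.+1%:R : R) => k k0; field; rewrite gt_eqF.
  apply: ler_piMr; first by rewrite divr_ge0// ltW.
  by rewrite ler_pdivrMr// mul1r ler_nat.
rewrite -[proj v](subrK v) -addrA; apply: le_trans (enormD_le _ _) _.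
by have := proj_dist v w wr; lra.
Qed.

End euclidean_ball.

(** Continuity from below: a bound uniform over finite unions passes to the countable union without
    the loss of a union bound. *)
Lemma probability_bigcup_le disp (T : measurableType disp) (R : realType)
    (P : probability T R) (E : nat -> set T) (c : \bar R) :
  (forall i, measurable (E i)) ->
  (forall k, (P (\bigcup_(i < k.+1) E i) <= c)%E) -> (P (\bigcup_i E i) <= c)%E.
Proof.
move=> mE Ec; pose F k := \bigcup_(i < k.+1) E i.
have mF k : measurable (F k) by apply: bigcup_measurable => i _; exact: mE.
have EF : \bigcup_i E i = \bigcup_k F k.
  apply/seteqP; split=> [z [i _ Ei]|z [k _ [i _ Ei]]]; last by exists i.
  by exists i => //; exists i => //=.
have ndF : nondecreasing_seq F.
  move=> a b ab; apply/subsetPset => z [i /= ia Ei]; exists i => //=.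
  exact: leq_trans ia _.
have cF := @nondecreasing_cvg_mu _ T R P F mF (bigcupT_measurable F mF) ndF.
rewrite EF -(cvg_lim _ cF)//; apply: lime_le; first by apply/cvg_ex; eexists; exact: cF.
by apply: nearW => k; exact: Ec.
Qed.

Section uniform_smoothing_error.
Context {disp : measure_display} {T : measurableType disp} {R : realType} {d n : nat}.
Context (D : probability T R) (x : T -> 'rV[R]_d) (y : T -> R) (M Y rho s r : R).
Hypothesis n0 : (0 < n)%N.
Hypothesis mx : forall i, measurable_fun setT (fun p => x p ord0 i).
Hypothesis my : measurable_fun setT y.
Hypothesis xM : forall p, enorm (x p) <= M.
Hypothesis yY : forall p, `|y p| <= Y.
Hypothesis rho0 : 0 < rho.
Hypothesis s0 : 0 < s.
Hypothesis M0 : 0 < M.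
Hypothesis r0 : 0 <= r.
Implicit Types (v w : 'rV[R]_d) (S : n.-tuple T).

Definition smoothing_error w p : R := smoothed_loss x y rho s w p - linear_loss x y rho w p.

Lemma bounded_mfun_smoothing_error w : bounded_mfun (smoothing_error w).
Proof.
apply: bounded_mfunB.
  exact: (bounded_mfun_smoothed_loss (M := M) (Y := Y)).
exact: (bounded_mfun_linear_loss mx my xM yY).
Qed.

Lemma smoothing_error_lipschitz v w p :
  `|smoothing_error v p - smoothing_error w p| <=
  s * M / rho * `|dotp v (x p) - dotp w (x p)|.
Proof.
rewrite /smoothing_error /smoothed_loss /linear_loss !(huberE _ (dotp _ _)).
apply: le_trans (smoothed_huber_lipschitz rho0 s0 _ _ _) _.
rewrite (_ : dotp v (x p) - y p - (dotp w (x p) - y p) = dotp v (x p) - dotp w (x p)); last by ring.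
apply: ler_wpM2r => //; rewrite ler_pM2r ?invr_gt0//; apply: ler_wpM2l => //.
exact: ltW.
Qed.

Let m w := \int[D]_p smoothing_error w p.
Let dev w S := \sum_(j < n) (smoothing_error w (tnth S j) - m w).

Let bounded_mfun_dev w : bounded_mfun (dev w).
Proof.
apply: bounded_mfun_sum => j; apply: bounded_mfunB; last exact: bounded_mfun_cst.
exact: (bounded_mfun_comp (measurable_tnth j) (bounded_mfun_smoothing_error w)).
Qed.

Let kappa := s * M / rho.
Let kappa0 : 0 <= kappa.
Proof. by rewrite divr_ge0 ?mulr_ge0// ltW. Qed.
Let B := s ^+ 2 * M ^+ 2 / (2 * rho).
Let B0 : 0 < B.
Proof. by rewrite divr_gt0 ?mulr_gt0// exprn_gt0. Qed.
(** The first term is [sup_deviation_mean_le] at [u = 0], the second McDiarmid's deviation for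
    one-observation changes at most [B]; [dev] is a sum, so neither is divided by [n] yet. *)
Let tau dl := 2 * kappa * M * r * Num.sqrt n%:R + B * Num.sqrt (n%:R * ln dl^-1 / 2).

Let finite_dev_tail k (W : 'I_k.+1 -> 'rV[R]_d) dl : 0 < dl <= 1 ->
  (forall i, enorm (W i) <= r) ->
  (power_prob D n [set S | (tau dl < bmax (fun i => dev (W i) S))%R] <= dl%:E)%E.
Proof.
move=> dl01 Wr.
have bf : bounded_mfun (fun S => bmax (fun i => dev (W i) S)).
  exact: bounded_mfun_bmax.
(* The smoothing error lies in [[0, B]], so replacing one observation moves every [dev (W i)], hence
   their maximum, by at most [B]. *)
have bd : bounded_differences (fun S => bmax (fun i => dev (W i) S)) B.
  move=> j S S' SS'; rewrite lerBlDr; apply: bmax_le => i.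
  rewrite -lerBlDr; apply: le_trans (_ : dev (W i) S - dev (W i) S' <= _).
    by rewrite lerD2l lerN2; exact: (le_bmax (fun i => dev (W i) S')).
  rewrite /dev -sumrB (bigD1 j)//= big1 ?addr0 => [|l lj]; last by rewrite SS'// subrr.
  have /andP[a1 a2] := smoothed_loss_bounds y xM rho0 s0 (W i) (tnth S j).
  have /andP[b1 b2] := smoothed_loss_bounds y xM rho0 s0 (W i) (tnth S' j).
  rewrite -/(smoothing_error _ _) -/B in a1 a2; rewrite -/(smoothing_error _ _) -/B in b1 b2.
  by lra.
apply: le_trans (mcdiarmid D n0 B0 dl01 bf bd); apply: le_measure; rewrite ?inE.
- exact: measurable_set_gt bf.1.
- exact: measurable_set_gt bf.1.
move=> S /=; apply: le_lt_trans; rewrite lerD2r.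
have md w : measurable_fun setT (fun p => dotp w (x p)).
  by apply: measurable_sum => i; exact: measurable_funM.
have := sup_deviation_mean_le D md xM Wr
  (fun i => bounded_mfun_smoothing_error (W i))
  (fun i j p => smoothing_error_lipschitz (W i) (W j) p) n 0.
rewrite dotp0 add0r sqrtrM// sqrtr_sqr ger0_norm; last first.
  by apply: mulr_ge0; [exact: mulr_ge0|exact: ltW].
rewrite (_ : 2 * kappa * M * r * Num.sqrt n%:R =
  r * (Num.sqrt n%:R * (2 * kappa * M))); last by ring.
apply: le_trans; rewrite le_eqVlt; apply/orP; left; apply/eqP.
apply: eq_Rintegral => S' _; congr bmax; apply/funext => i.
by rewrite dotp0 add0r.
Qed.

(** The exceptional set is a countable union over a dense sequence, hence measurable; outside it,
    Lipschitz continuity in [w] extends the bound to the whole ball. *)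
Lemma smoothing_error_tail dl : 0 < dl <= 1 -> exists A : set (n.-tuple T),
  [/\ measurable A, (power_prob D n A <= dl%:E)%E &
    forall S w, ~ A S -> enorm w <= r ->
      empirical_mean (smoothing_error w) S - \int[D]_p smoothing_error w p <=
      2 * r * s * M ^+ 2 / (rho * Num.sqrt n%:R) +
      s ^+ 2 * M ^+ 2 / (2 * rho) * Num.sqrt (ln dl^-1 / (2 * n%:R))].
Proof.
move=> dl01; have n0' : (0 : R) < n%:R by rewrite ltr0n.
have [W [Wr Wdense]] := @dense_enorm_ball R d r r0.
pose E i := [set S | tau dl < dev (W i) S].
have mE i : measurable (E i) by apply: measurable_set_gt; exact: (bounded_mfun_dev _).1.
exists (\bigcup_i E i); split; first exact: bigcupT_measurable.
  apply: probability_bigcup_le => // k.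
  have h := @finite_dev_tail k (fun i => W i) dl dl01 (fun i => Wr i).
  apply: le_trans h; apply: le_measure; rewrite ?inE.
  - by apply: bigcup_measurable => i _; exact: mE.
  - apply: measurable_set_gt; have : bounded_mfun (fun S => bmax (fun i : 'I_k.+1 => dev (W i) S)).
      exact: bounded_mfun_bmax.
    by case.
  move=> S [i /= ik Ei]; apply: lt_le_trans Ei _.
  exact: (le_bmax (fun i : 'I_k.+1 => dev (W i) S) (Ordinal ik)).
move=> S w nA wr.
have devW i : dev (W i) S <= tau dl.
  by rewrite leNgt; apply/negP => h; apply: nA; exists i.
have devw : dev w S <= tau dl.
  apply/ler_addgt0Pr => e e0.
  (* [2 n kappa M] is a Lipschitz constant of [dev] in [w]; adding [1] makes positivity
     immediate. *)
  pose c := 2 * n%:R * kappa * M + 1.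
  have c0 : 0 < c.
    by apply: ltr_wpDl => //; apply: mulr_ge0; [rewrite mulr_ge0|exact: ltW].
  have [i Wi] := Wdense w (e / c) wr (divr_gt0 e0 c0).
  have lipi p : `|smoothing_error w p - smoothing_error (W i) p| <= kappa * (M * (e / c)).
    apply: le_trans (smoothing_error_lipschitz _ _ _) _; apply: ler_wpM2l => //.
    rewrite distrC -dotpNl -dotpDl; apply: le_trans (normr_dotp_le _ _) _.
    by rewrite mulrC; apply: ler_pM => //; exact: enorm_ge0.
  have bw := bounded_mfun_smoothing_error w.
  have bi := bounded_mfun_smoothing_error (W i).
  have mwi : m (W i) - m w <= kappa * (M * (e / c)).
    rewrite /m -RintegralB_bounded//; apply: Rintegral_le_cst; first exact: bounded_mfunB.
    by move=> p; apply: le_trans (ler_norm _) _; rewrite distrC.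
  have : dev w S - dev (W i) S <= \sum_(j < n) (2 * (kappa * (M * (e / c)))).
    rewrite /dev -sumrB; apply: ler_sum => j _.
    have := le_trans (ler_norm _) (lipi (tnth S j)); move: mwi.
    by move: (kappa * _) => z; lra.
  rewrite sumr_const card_ord -mulr_natl => h.
  have ce : n%:R * (2 * (kappa * (M * (e / c)))) <= e.
    rewrite (_ : n%:R * _ = 2 * n%:R * kappa * M * (e / c)); last by ring.
    rewrite mulrA ler_pdivrMr// mulrC ler_pM2l//.
    by rewrite /c lerDl.
  by have := devW i; lra.
have -> : empirical_mean (smoothing_error w) S - \int[D]_p smoothing_error w p =
    n%:R^-1 * dev w S.
  rewrite /dev sumrB sumr_const card_ord -[m w *+ _]mulr_natl mulrBr mulrA mulVf ?mul1r//.
  by rewrite gt_eqF.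
apply: (@le_trans _ _ (n%:R^-1 * tau dl)).
  by apply: ler_wpM2l => //; rewrite invr_ge0.
rewrite /tau mulrDr le_eqVlt; apply/orP; left; apply/eqP; congr (_ + _).
  rewrite -[X in X^-1](sqr_sqrtr (ltW n0')) /kappa.
  have sn0 : 0 < Num.sqrt n%:R :> R by rewrite sqrtr_gt0.
  by field; rewrite !gt_eqF.
rewrite /B mulrCA; congr (_ * _).
have -> : n%:R * ln dl^-1 / 2 = n%:R ^+ 2 * (ln dl^-1 / (2 * n%:R)).
  by field; rewrite gt_eqF.
by rewrite sqrtrM ?sqr_ge0// sqrtr_sqr ger0_norm ?ltW// mulKf// gt_eqF.
Qed.

End uniform_smoothing_error.

(** * The generalization bound *)

Lemma probability_setC_ge disp (T : measurableType disp) (R : realType)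
    (P : probability T R) (A : set T) (dl : R) : measurable A ->
  (P A <= dl%:E)%E -> ((1 - dl)%:E <= P (~` A))%E.
Proof.
move=> mA PA; rewrite probability_setC// EFinB leeB//.
Qed.

Section huber_generalization.
Context {disp : measure_display} {T : measurableType disp} {R : realType} {d n : nat}.
Context (D : probability T R) (x : T -> 'rV[R]_d) (y : T -> R) (M Y H rho s r dl : R).
Hypothesis n0 : (0 < n)%N.
Hypothesis mx : forall i, measurable_fun setT (fun p => x p ord0 i).
Hypothesis my : measurable_fun setT y.
Hypothesis xM : forall p, enorm (x p) <= M.
Hypothesis yY : forall p, `|y p| <= Y.
Hypothesis yH : forall p, huber rho 0 (y p) <= H.
Hypothesis rho0 : 0 < rho.
Hypothesis s0 : 0 < s.
Hypothesis r0 : 0 <= r.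
Hypothesis dl0 : 0 < dl.
Hypothesis dl1 : dl <= 1.
Implicit Types (w : 'rV[R]_d) (S : n.-tuple T).

Notation loss := (linear_loss x y rho).
Notation gap := (risk_gap D x y rho).

Let n0' : (0 : R) < n%:R. Proof. by rewrite ltr0n. Qed.
Let sn0 : 0 < Num.sqrt (n%:R : R). Proof. by rewrite sqrtr_gt0. Qed.
Let M0 : 0 <= M := le_trans (enorm_ge0 _) (xM point).

(** Hoeffding for a loss with values in [[0, H]], at level [dl / 2]; if [H = 0] that loss vanishes
    and no sample is exceptional. *)
Lemma risk_gap0_tail : exists A : set (n.-tuple T),
  [/\ measurable A, (power_prob D n A <= (dl / 2)%:E)%E & forall S, ~ A S ->
     gap 0 S <= H * Num.sqrt (ln (2 / dl) / (2 * n%:R))].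
Proof.
have l0E p : loss 0 p = huber rho 0 (y p) by rewrite /linear_loss dotpC dotp0.
have H0 : 0 <= H := le_trans (huber_ge0 rho0 _ _) (yH point).
have [H_eq0|H_neq0] := eqVneq H 0.
  exists set0; split => //.
    by rewrite measure0 lee_fin divr_ge0// ltW.
  move=> S _; have l00 p : loss 0 p = 0.
    by apply/eqP; rewrite eq_le l0E huber_ge0// andbT; have := yH p; rewrite H_eq0.
  rewrite H_eq0 mul0r /risk_gap /empirical_mean big1 => [|i _]; last exact: l00.
  rewrite mulr0 subr0 (@eq_Rintegral _ _ _ _ _ (fun=> 0)) => [|p _]; last exact: l00.
  by rewrite Rintegral_prob_cst.
have H_gt0 : 0 < H by rewrite lt_neqAle eq_sym H_neq0.
have dl2 : 0 < dl / 2 <= 1 by rewrite divr_gt0//= ler_pdivrMr//; have := dl1; lra.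
have bl : bounded_mfun (loss 0) by exact: (bounded_mfun_linear_loss mx my xM yY).
exists [set S | H * Num.sqrt (ln (2 / dl) / (2 * n%:R)) < gap 0 S]; split.
- by apply: measurable_set_gt; case: (bounded_mfun_risk_gap D (n := n) mx my xM yY rho0 0).
- have := hoeffding D n0 H_gt0 dl2 bl; rewrite invf_div; apply.
  by move=> p q; rewrite !l0E; have := yH p; have := huber_ge0 rho0 0 (y q); lra.
- by move=> S /= /negP; rewrite -leNgt.
Qed.

Lemma huber_generalization : exists G : set (n.-tuple T),
  [/\ measurable G, ((1 - dl)%:E <= power_prob D n G)%E &
   forall S w, G S -> enorm w <= r ->
    \int[D]_p loss w p <= empirical_mean (loss w) S
     + 2 * r * s * M ^+ 2 / (rho * Num.sqrt n%:R)
     + 4 * M ^+ 2 * s ^+ 2 / rho * Num.sqrt (2 * ln (16 / dl) / n%:R)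
     + H * Num.sqrt (ln (2 / dl) / (2 * n%:R))
     + M * Num.sqrt (d.+1)%:R / (2 * s * Num.sqrt n%:R) * enorm w ^+ 2
     + M * s * Num.sqrt (d.+1)%:R / Num.sqrt n%:R * (ln (4 / dl) + 1 / 2)].
Proof.
have [A1 [mA1 PA1 A1P]] := risk_gap0_tail.
(* [l] divides by [M]. If [M = 0] every input is zero, all predictors have the loss of [0], and
   [A1P] alone suffices. *)
have [M_eq0|M_neq0] := eqVneq M 0.
  exists (~` A1); split; first exact: measurableC.
    apply: probability_setC_ge => //; apply: le_trans PA1 _; rewrite lee_fin.
    by rewrite ler_pdivrMr//; have := dl0; lra.
  move=> S w /A1P gS _; rewrite M_eq0 expr0n/= !(mulr0, mul0r, addr0).
  have x0 p : x p = 0.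
    by apply/enorm_eq0/eqP; rewrite eq_le enorm_ge0 andbT; have := xM p; rewrite M_eq0.
  have -> : loss w = loss 0 by apply/funext => p; rewrite /linear_loss x0 !dotp0.
  by move: gS; rewrite /risk_gap; lra.
have M_gt0 : 0 < M by rewrite lt_neqAle eq_sym M_neq0.
have sd0 : 0 < Num.sqrt (d.+1%:R : R) by rewrite sqrtr_gt0 ltr0n.
pose l := Num.sqrt n%:R / (M * s * Num.sqrt (d.+1)%:R).
have l0 : 0 < l by rewrite divr_gt0 ?mulr_gt0.
have lE : l ^+ 2 * M ^+ 2 * s ^+ 2 * d.+1%:R = n%:R.
  rewrite -[X in _ * X = _](sqr_sqrtr (ler0n _ _)) -[RHS](sqr_sqrtr (ltW n0')) /l.
  move: (Num.sqrt (d.+1%:R : R)) sd0 => k k0.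
  by field; rewrite !gt_eqF.
have dl4 : 0 < dl / 4 by rewrite divr_gt0.
have dl41 : 0 < dl / 4 <= 1 by rewrite dl4 ler_pdivrMr//; have := dl1; lra.
pose K := expR 2^-1 / (dl / 4).
have K0 : 0 < K by rewrite divr_gt0 ?expR_gt0.
have lnK' : ln K = ln (4 / dl) + 1 / 2.
  rewrite /K invf_div lnM ?posrE ?expR_gt0 ?divr_gt0// expRK addrC.
  by rewrite mul1r.
have PA2 := risk_gap_mgf_tail D n0 mx my xM yY rho0 s0 l0 dl4 lE.
set A2 := [set S | _] in PA2.
have mA2 : measurable A2.
  rewrite /A2 -[X in measurable X]setTI; apply: emeasurable_fun_o_infty => //.
  exact: (measurable_risk_gap_mgf D s mx my xM yY rho0).
have [A3 [mA3 PA3 A3P]] := smoothing_error_tail D n0 mx my xM yY rho0 s0 M_gt0 r0 dl41.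
have mA : measurable (A1 `|` A2 `|` A3) by apply: measurableU => //; exact: measurableU.
exists (~` (A1 `|` A2 `|` A3)); split; first exact: measurableC.
  apply: probability_setC_ge => //.
  apply: le_trans (measureU2 _ _ _) _ => //; first exact: measurableU.
  apply: le_trans (leeD2r _ (measureU2 _ mA1 mA2)) _.
  apply: le_trans (leeD (leeD PA1 PA2) PA3) _.
  by rewrite -!EFinD lee_fin; lra.
move=> S w nS wr.
have nA1 : ~ A1 S by move=> h; apply: nS; left; left.
have nA2 : ~ A2 S by move=> h; apply: nS; left; right.
have nA3 : ~ A3 S by move=> h; apply: nS; right.
have h1 := A1P S nA1; have h3 := A3P S w nA3 wr.
have ZK : (risk_gap_mgf D x y rho s l S <= K%:E)%E by rewrite leNgt; apply/negP.
have h2 := smoothed_risk_gap_le mx my xM yY rho0 s0 w l0 K0 ZK.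
have bsm : bounded_mfun (smoothed_loss x y rho s w).
  exact: (bounded_mfun_smoothed_loss (M := M) (Y := Y)).
have blo : bounded_mfun (loss w) by exact: (bounded_mfun_linear_loss mx my xM yY).
have E1 : \int[D]_p smoothing_error x y rho s w p =
    \int[D]_p smoothed_loss x y rho s w p - \int[D]_p loss w p.
  by rewrite -RintegralB_bounded.
have E2 : empirical_mean (smoothing_error x y rho s w) S =
    empirical_mean (smoothed_loss x y rho s w) S - empirical_mean (loss w) S.
  by rewrite /empirical_mean -mulrBr -sumrB.
rewrite E1 E2 in h3.
have E3 : l^-1 * (dotp w w / (2 * s ^+ 2) + ln K) =
    M * Num.sqrt (d.+1)%:R / (2 * s * Num.sqrt n%:R) * enorm w ^+ 2
     + M * s * Num.sqrt (d.+1)%:R / Num.sqrt n%:R * (ln (4 / dl) + 1 / 2).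
  rewrite lnK' enorm_sqr mulrDr /l invf_div; congr (_ + _).
  by field; rewrite !gt_eqF.
rewrite E3 in h2.
(* The smoothing deviation comes out with factor [1 / 2] and [ln (4 / dl) / (2 n)]; the claimed [4]
   and [2 ln (16 / dl) / n] are larger. *)
have h4 : s ^+ 2 * M ^+ 2 / (2 * rho) * Num.sqrt (ln (dl / 4)^-1 / (2 * n%:R)) <=
    4 * M ^+ 2 * s ^+ 2 / rho * Num.sqrt (2 * ln (16 / dl) / n%:R).
  apply: ler_pM.
  - by rewrite divr_ge0 ?mulr_ge0 ?sqr_ge0// ltW.
  - exact: sqrtr_ge0.
  - rewrite -subr_ge0 (_ : _ - _ = 7 / 2 * (M ^+ 2 * s ^+ 2 / rho)); last first.
      by field; rewrite gt_eqF.
    by rewrite mulr_ge0 ?divr_ge0 ?mulr_ge0 ?sqr_ge0// ltW.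
  apply: ler_wsqrtr; rewrite invf_div invfM mulrA ler_pM2r ?invr_gt0//.
  have ln4 : 0 <= ln (4 / dl).
    by rewrite ln_ge0// ler_pdivlMr// mul1r; have := dl1; lra.
  have : ln (4 / dl) <= ln (16 / dl).
    by rewrite ler_ln ?posrE ?divr_gt0// ler_pM2r ?invr_gt0// ler_nat.
  by lra.
move: h1 h2 h3 h4; rewrite /risk_gap.
set a1 := \int[D]_p smoothed_loss _ _ _ _ _ _; set a2 := \int[D]_p loss w p.
set a3 := \int[D]_p loss 0 p; set e1 := empirical_mean (smoothed_loss _ _ _ _ _) _.
set e2 := empirical_mean (loss w) _; set e3 := empirical_mean (loss 0) _.
set b1 := _ * enorm w ^+ 2; set b2 := _ * (ln (4 / dl) + 1 / 2).
set b3 := H * _; set b4 := 2 * r * s * _ / _; set b5 := 4 * _ * _ / _ * _.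
set b6 := _ * Num.sqrt (ln _^-1 / _).
clearbody a1 a2 a3 e1 e2 e3 b1 b2 b3 b4 b5 b6.
by lra.
Qed.

End huber_generalization.

(** * From data bounded everywhere to data bounded almost surely *)

Section borel_row_vectors.
Context {R : realType} {d : nat}.

Lemma measurable_coord (i : 'I_d) :
  measurable_fun setT (fun v : borel_rV R d => (v : 'rV[R]_d) ord0 i : R).
Proof.
apply: (measurability _ (RGenOInfty.measurableE R)) => _ [_ [a ->] <-].
rewrite setTI; apply: sub_sigma_algebra.
have cv : continuous (fun v : 'rV[R]_d => v ord0 i) by exact: coord_continuous.
move/continuousP : cv; apply.
exact: interval_open.
Qed.

Lemma measurable_dotpr (w : 'rV[R]_d) :
  measurable_fun setT (fun v : borel_rV R d => dotp w v : R).
Proof.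
apply: measurable_sum => i; apply: measurable_funM => //; exact: measurable_coord.
Qed.

Lemma measurable_enorm : measurable_fun setT (fun v : borel_rV R d => enorm (v : 'rV[R]_d)).
Proof.
apply: (measurableT_comp (continuous_measurable_fun (@sqrt_continuous R))).
by apply: measurable_sum => i; apply: measurable_funM; exact: measurable_coord.
Qed.

End borel_row_vectors.

(** The losses are bounded above by [Y], so the real [sup] is a genuine supremum and not a default
    value. *)
Lemma huber_le_max (R : realType) (rho Y y : R) : 0 < rho -> `|y| <= Y ->
  huber rho 0 y <= huber_max rho Y.
Proof.
move=> rho0 yY; apply: sup_upper_bound; last by exists y.
split; first by exists (huber rho 0 y), y.
exists Y => _ [z /= zY <-]; rewrite huberE sub0r.
by apply: le_trans (huber_le_norm rho0 _) _; rewrite normrN.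
Qed.

Lemma power_prob_all disp (T : measurableType disp) (R : realType)
    (D : probability T R) n (A : set T) : measurable A -> D A = 1%E ->
  measurable [set S : n.-tuple T | forall i, A (tnth S i)] /\
  power_prob D n [set S | forall i, A (tnth S i)] = 1%E.
Proof.
move=> mA DA; split.
  rewrite (_ : [set _ | _] = \bigcap_(i in [set: 'I_n]) (fun S => tnth S i) @^-1` A).
    apply: fin_bigcap_measurable => // i _; rewrite -[X in measurable X]setTI.
    exact: measurable_tnth.
  by apply/seteqP; split => S /= h i; [move=> _|]; exact: h.
by rewrite (power_probE D (fun=> mA)) big1.
Qed.

Unset Implicit Arguments.
Set Strict Implicit.

Theorem corollary4p6 (R : realType) (d n : nat) (X : set 'rV[R]_d)
    (M rho Ymax r sigma delta : R)
    (D : probability (borel_rV R d * R)%type R)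
    (P : probability (borel_rV R d) R)
    (n_gt0 : (0 < n)%N)
    (X_bounded : forall x, X x -> enorm x <= M)
    (rho_gt0 : 0 < rho)
    (D_X : {ae D, forall p, X p.1})
    (D_Ymax : {ae D, forall p, `|p.2| <= Ymax})
    (sigma_gt0 : 0 < sigma)
    (P_gaussian : P = gaussian_prob d sigma)
    (delta_gt0 : 0 < delta) (delta_le1 : delta <= 1) :
  let Theta := [set w : 'rV[R]_d | enorm w <= r] in
  holds_with_prob_ge (power_prob D n) (1 - delta)
    [set S | forall w, Theta w ->
      (true_risk rho D (dotp w) <=
        (emp_risk rho S (dotp w)
         + 2 * r * sigma * M ^+ 2 / (rho * Num.sqrt n%:R)
         + 4 * M ^+ 2 * sigma ^+ 2 / rho
           * Num.sqrt (2 * ln (16 / delta) / n%:R)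
         + huber_max rho Ymax * Num.sqrt (ln (2 / delta) / (2 * n%:R))
         + M * Num.sqrt (d.+1)%:R / (2 * sigma * Num.sqrt n%:R) * enorm w ^+ 2
         + M * sigma * Num.sqrt (d.+1)%:R / Num.sqrt n%:R
           * (ln (4 / delta) + 1 / 2))%:E)%E].
Proof.
move=> Theta; rewrite /Theta {Theta P P_gaussian}.
(* A negative radius makes the ball empty. *)
have [r_lt0|r0] := ltP r 0.
  exists setT; split => //.
    by move=> S _ w /= wr; have := le_lt_trans (le_trans (enorm_ge0 w) wr) r_lt0; rewrite ltxx.
  by rewrite probability_setT lee_fin gerBl ltW.
(* [X] is not assumed measurable; [A] is a measurable set that contains almost every point thanks to
   the norm bound on [X]. *)
pose A : set (borel_rV R d * R) := [set p | enorm (p.1 : 'rV[R]_d) <= M /\ `|p.2| <= Ymax].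
have mA : measurable A.
  rewrite (_ : A = [set p | enorm (p.1 : 'rV[R]_d) <= M] `&` [set p | `|p.2| <= Ymax])//.
  have mn : measurable_fun setT (fun p : borel_rV R d * R => enorm (p.1 : 'rV[R]_d)).
    exact: (measurableT_comp measurable_enorm).
  have ma : measurable_fun setT (fun p : borel_rV R d * R => `|p.2|).
    exact: measurableT_comp.
  have le_set (f : borel_rV R d * R -> R) c : measurable_fun setT f ->
      measurable [set p | f p <= c].
    move=> mf; rewrite (_ : [set p | _] = ~` [set p | c < f p]).
      exact/measurableC/measurable_set_gt.
    by apply/seteqP; split => p /=; rewrite leNgt => /negP.
  by apply: measurableI; exact: le_set.
have A_ae : D.-negligible (~` A).
  apply: negligibleS (negligibleU D_X D_Ymax) => p nAp.
  have [Xp|] := pselect (X p.1); last by left.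
  by right => Yp; apply: nAp; split => //; exact: X_bounded.
have DA : D A = 1%E.
  have : D (~` A) = 0%E by apply: measure_negligible => //; exact: measurableC.
  rewrite probability_setC// => /eqP; rewrite sube_eq ?fin_num_measure//.
  by rewrite add0e => /eqP <-.
(* A point of [A] shows that [M] and [Ymax] are nonnegative, which the default value [0] below
   requires. *)
have [p0 [p0M p0Y]] : A !=set0.
  apply/set0P/eqP => A0; move: DA; rewrite A0 measure0 => /eqP.
  by rewrite eq_sym onee_eq0.
have M0 : 0 <= M := le_trans (enorm_ge0 _) p0M.
have Y0 : 0 <= Ymax := le_trans (normr_ge0 _) p0Y.
(* Replacing the data by [0] off [A] makes the bounds hold everywhere; the true risk is unchanged,
   and so is the empirical risk of samples lying in [A]. *)
pose x (p : borel_rV R d * R) : 'rV[R]_d := if p \in A then p.1 else 0.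
pose y (p : borel_rV R d * R) : R := if p \in A then p.2 else 0.
have mI : measurable_fun setT (fun p : borel_rV R d * R => p \in A).
  by apply: (measurable_fun_bool true); rewrite setTI preimage_mem_true.
have mx i : measurable_fun setT (fun p => x p ord0 i).
  rewrite (_ : (fun p => _) = fun p => if p \in A then (p.1 : 'rV[R]_d) ord0 i else 0).
    apply: measurable_fun_ifT => //.
    exact: (measurableT_comp (measurable_coord i)).
  by apply/funext => p; rewrite /x; case: ifP => //; rewrite mxE.
have my : measurable_fun setT y by exact: measurable_fun_ifT.
have xM p : enorm (x p) <= M.
  by rewrite /x; case: ifPn => [/[!inE] -[]|_] //; rewrite /enorm dotp0 sqrtr0.
have yY p : `|y p| <= Ymax.
  by rewrite /y; case: ifPn => [/[!inE] -[]|_] //; rewrite normr0.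
have [G [mG PG GP]] := huber_generalization D n_gt0 mx my xM yY
  (fun p => huber_le_max rho_gt0 (yY p)) rho_gt0 sigma_gt0 r0 delta_gt0 delta_le1.
have [mAn PAn] := power_prob_all n mA DA.
exists (G `&` [set S | forall i, A (tnth S i)]); split; first exact: measurableI.
- move=> S [GS AS] w /= wr.
  have risk : true_risk rho D (dotp w) = (\int[D]_p linear_loss x y rho w p)%:E.
    rewrite EFin_Rintegral; last first.
      exact/bounded_mfun_integrable/(bounded_mfun_linear_loss mx my xM yY).
    rewrite /true_risk unlock; apply: ae_eq_integral => //.
    - apply/measurable_EFinP/measurable_huber => //.
      exact: (measurableT_comp (measurable_dotpr w)).
    - apply/measurable_EFinP.
      by have [] := bounded_mfun_linear_loss mx my xM yY rho_gt0 w.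
    apply: negligibleS A_ae => p + Ap; apply => _.
    by rewrite /linear_loss /x /y mem_set.
  rewrite risk lee_fin.
  have -> : emp_risk rho S (dotp w) = empirical_mean (linear_loss x y rho w) S.
    congr (_ * _); apply: eq_bigr => i _.
    by rewrite /linear_loss /x /y mem_set//; exact: AS.
  exact: GP.
(* Samples lying entirely in [A] have probability one, so intersecting [G] with them costs
   nothing. *)
set An := [set S | _] in mAn PAn *.
apply: le_trans PG _; apply: (@le_trans _ _ (power_prob D n ((G `&` An) `|` ~` An))).
  apply: le_measure; rewrite ?inE//.
    by apply: measurableU; [exact: measurableI|exact: measurableC].
  by move=> S GS; have [AS|AS] := pselect (An S); [left|right].
apply: le_trans (measureU2 _ _ _) _; [exact: measurableI|exact: measurableC|].
by rewrite [X in (_ + X)%E]probability_setC// PAn subee// adde0.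
Qed.
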